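(* Let $Z_1,Z_2,\ldots$ be exchangeable random elements such that, conditionally on $\tilde\mu$, the $Z_j$ are i.i.d. with distribution ${\rm BeP}(\tilde\mu)$, where $\tilde\mu\sim {\rm SP}(\nu,f_{\Psi_1})$ is a scaled process on $(\mathbb{W},\mathscr{W})$ with $\nu(dw,ds)=\lambda(s)\,ds\,P(dw)$. For $n\ge 1$ let $\mathbf{Z}_n=(Z_1,\ldots,Z_n)$ be a random sample displaying $K_n=k$ distinct features $\{W_1^*,\ldots,W_{K_n}^*\}$, feature $W_i^*$ appearing exactly $M_{n,i}=m_i$ times in the sample, $i=1,\ldots,K_n$. Suppose that, for some $r>0$, the density $f_{\Psi_1}$ is continuous on $(0,r)$ with support $(0,r)$, and that $\lambda:\mathbb{R}^+\to\mathbb{R}^+$ is continuous on its domain. Then the conditional distribution of the latent variable $\Psi_1$ given $\mathbf{Z}_n$ depends on the sampling information $\mathbf{Z}_n$ only through $n$ if and only if there is a constant $C>0$ such that $\lambda(s)=C s^{-1}$ for all $s\in(0,r)$.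
   Context: Setting. $\mathbb{W}$ is a Polish space (of feature labels) with Borel $\sigma$-algebra $\mathscr{W}$, and $P$ is a diffuse (non-atomic) probability measure on it. $\mathbb{R}^+$ denotes the positive half-line; $\lambda:\mathbb{R}^+\to\mathbb{R}^+$ is a measurable function with values in the nonnegative reals. Bernoulli process. For a discrete measure $\mu=\sum_{i\ge1}p_i\delta_{w_i}$ with distinct $w_i\in\mathbb{W}$ and masses $p_i\in(0,1)$, ${\rm BeP}(\mu)$ is the law of $\sum_{i\ge1}A_i\delta_{w_i}$, where the $A_i$ are independent Bernoulli variables with parameters $p_i$. If $Z_j=\sum_i A_{j,i}\delta_{\tilde w_i}$, individual $j$ displays feature $\tilde w_i$ iff $A_{j,i}=1$. The distinct features displayed by at least one of $Z_1,\ldots,Z_n$ are $W_1^*,\ldots,W_{K_n}^*$, and $M_{n,i}$ is the number of individuals among $1,\ldots,n$ displaying $W_i^*$. Completely random measure (CRM). Let $\nu(dw,ds)=\lambda(s)\,ds\,P(dw)$ with $\int_0^\infty\min\{s,1\}\lambda(s)\,ds<\infty$ and $\int_0^\infty\lambda(s)\,ds=\infty$. The CRM with Lévy intensity $\nu$ is the random measure $\sum_{i\ge1}\tilde\tau_i\delta_{\tilde w_i}$, where $(\tilde w_i,\tilde\tau_i)_{i\ge1}$ are the points of a Poisson process on $\mathbb{W}\times(0,\infty)$ with intensity measure $\nu$. Scaled process (SP). Let $\Delta_1>\Delta_2>\cdots$ be the decreasingly ordered jumps $(\tilde\tau_i)$ of this CRM. Let $\mathscr{L}(\cdot,a)$ be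 the regular version of the conditional distribution of $(\Delta_{i+1}/\Delta_1)_{i\ge1}$ given $\Delta_1=a$ for which, under $\mathscr{L}(\cdot,a)$, the sequence is the decreasingly ordered sequence of points of a Poisson process on $(0,1)$ with intensity $a\lambda(as)\,ds$. Let $\Psi_1$ be a positive random variable with probability density $f_{\Psi_1}$. Conditionally on $\Psi_1=a$ let $(\tilde\eta_i)_{i\ge1}$ have law $\mathscr{L}(\cdot,a)$, so that $(\tilde\eta_i)_{i\ge1}$ has marginal law $\int\mathscr{L}(\cdot,a)f_{\Psi_1}(a)\,da$. Let $(\tilde w_i)_{i\ge1}$ be i.i.d. from $P$, independent of $(\Psi_1,(\tilde\eta_i)_{i\ge1})$. The law of $\tilde\mu=\sum_{i\ge1}\tilde\eta_i\delta_{\tilde w_i}$ is denoted ${\rm SP}(\nu,f_{\Psi_1})$. Given $\tilde\mu$, the sequence $(Z_j)_{j\ge1}$ is independent of the latent variable $\Psi_1$. Conventions. ''$f_{\Psi_1}$ has support $(0,r)$'' means that $f_{\Psi_1}$ vanishes outside $(0,r)$ and $\{a: f_{\Psi_1}(a)>0\}$ is dense in $(0,r)$. ''The conditional distribution of $\Psi_1$ given $\mathbf{Z}_n$ depends on $\mathbf{Z}_n$ only through $n$'' means that for every $n\ge1$ this conditional distribution, as a function of the sampling information $(n,k,m_1,\ldots,m_k)$ with $k\ge 0$ and $1\le m_i\le n$, does not depend on $k$ and $(m_1,\ldots,m_k)$. For every measurable $\lambda:\mathbb{R}^+\to\mathbb{R}^+$ with $\int_0^\infty\min\{s,1\}\lambda(s)\,ds<\infty$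 and $\int_0^\infty\lambda(s)\,ds=\infty$, every probability density $f_{\Psi_1}$ on $(0,\infty)$, and every value $(n,k,m_1,\ldots,m_k)$ of the sampling information with $n\ge1$, $k\ge0$ and $1\le m_i\le n$, the conditional density of $\Psi_1$ given $\mathbf{Z}_n$ is (a known fact) $$f_{\Psi_1\mid\mathbf{Z}_n}(a)\propto \exp\Big\{-\sum_{i=1}^n\int_0^1 s(1-s)^{i-1}a\lambda(as)\,ds\Big\}\ \prod_{i=1}^k\Big(\int_0^1 s^{m_i}(1-s)^{n-m_i}a\lambda(as)\,ds\Big)\ f_{\Psi_1}(a).$$ *)

(* Defs.v *)
From HB Require Import structures.
From mathcomp Require Import all_boot all_order all_algebra.
From mathcomp Require Import all_classical all_reals all_analysis measurable_realfun.

Set Implicit Arguments.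
Unset Strict Implicit.
Unset Printing Implicit Defensive.

Import Order.TTheory GRing.Theory Num.Theory.
Import numFieldNormedType.Exports.

Local Open Scope classical_set_scope.
Local Open Scope ring_scope.
Local Open Scope ereal_scope.

(* Borel sigma-algebra of a topological space, as a measurableType. *)
Notation borel W := (g_sigma_algebraType (@open W)).

Definition diffuse (d : measure_display) (T : measurableType d) (R : realType)
    (P : probability T R) : Prop :=
  forall x : T, P [set x] = 0.

(* The space T^nat with its product (cylinder) sigma-algebra. *)
Definition cylinders (d : measure_display) (T : measurableType d) :
    set (set (nat -> T)) :=
  [set E | exists i (B : set T),
     measurable B /\ E = (fun x : nat -> T => x i) @^-1` B].

Notation seqspace T := (g_sigma_algebraType (@cylinders _ T)).

(* Standing assumptions on lambda, which is only meaningful on ]0, +oo[;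
   they say that lambda is a Levy density of infinite activity. *)
Definition levy_density (R : realType) (lambda : R -> R) : Prop :=
  [/\ measurable_fun (`]0%R, +oo[%classic : set R) lambda,
      forall s : R, (0 < s)%R -> (0 <= lambda s)%R,
      \int[lebesgue_measure]_(s in `]0%R, +oo[)
        (Num.min s 1 * lambda s)%:E < +oo &
      \int[lebesgue_measure]_(s in `]0%R, +oo[) (lambda s)%:E = +oo].

(* Probability densities on ]0, +oo[. *)
Definition positive_density (R : realType) (f : R -> R) : Prop :=
  [/\ measurable_fun setT f,
      forall a : R, (0 <= f a)%R,
      forall a : R, (a <= 0)%R -> f a = 0%R &
      \int[lebesgue_measure]_a (f a)%:E = 1].

(* Poisson(mu) mass at k. For mu = +oo the count is infinite almost surely, so
   every finite k has mass 0. The library's [poisson_pmf] is not used because it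
   is 1 at every k when the rate is 0. *)
Definition poisson_mass (R : realType) (mu : \bar R) (k : nat) : R :=
  if mu is x%:E then (expR (- x) * x ^+ k / k`!%:R)%R else 0%R.

(* Under m, X 0 > X 1 > ... are the points, in decreasing order, of a Poisson
   process on U with intensity rate(s) ds: the numbers of points in disjoint
   measurable subsets of U are independent Poisson variables. *)
Definition ordered_poisson_points (R : realType) (d : measure_display)
    (Omega : measurableType d) (m : {measure set Omega -> \bar R})
    (X : nat -> Omega -> R) (U : set R) (rate : R -> R) : Prop :=
  [/\ forall i, measurable_fun setT (X i),
      {ae m, forall omega, forall i, U (X i omega)},
      {ae m, forall omega, forall i, (X i.+1 omega < X i omega)%R} &
      forall (n : nat) (B : 'I_n -> set R) (c : 'I_n -> nat),
        (forall l, measurable (B l)) -> (forall l, B l `<=` U) ->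
        trivIset setT B ->
        m [set omega | forall l : 'I_n,
             counting [set i | B l (X i omega)] = (c l)%:R%:E :> \bar R] =
        (\prod_(l < n) poisson_mass
           (\int[lebesgue_measure]_(s in B l) (rate s)%:E) (c l))%:E].

(* [L a] is the law L(., a): it is a regular conditional distribution of
   (Delta_{i+1} / Delta_1)_{i >= 1} given Delta_1 = a, where the Delta_i are the
   ordered jumps of the completely random measure with Levy intensity
   lambda(s) ds P(dw) (these do not involve the marks w, so they are the ordered
   points of a Poisson process with intensity lambda(s) ds), and it is the
   version for which L(., a) is, for every a > 0, the law of the ordered points
   of a Poisson process on (0, 1) with intensity a lambda(a s) ds. *)
Definition scaled_jumps_kernel (R : realType) (lambda : R -> R)
    (L : R.-pker R ~> seqspace R) : Prop :=
  (forall a : R, (0 < a)%R ->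
     ordered_poisson_points (L a) (fun i (x : seqspace R) => x i)
       `]0%R, 1%R[ (fun s => (a * lambda (a * s))%R)) /\
  (forall (d : measure_display) (Omega : measurableType d)
     (Pr : probability Omega R) (Delta : nat -> Omega -> R),
     ordered_poisson_points Pr Delta `]0%R, +oo[ lambda ->
     forall (D : set R) (E : set (seqspace R)), measurable D -> measurable E ->
       Pr [set omega | D (Delta 0%N omega) /\
             E (fun i => (Delta i.+1 omega / Delta 0%N omega)%R)] =
       \int[Pr]_(omega in Delta 0%N @^-1` D) L (Delta 0%N omega) E).

Section FeatureModel.
Context (R : realType) (W : completePseudoMetricType R)
  (d : measure_display) (Omega : measurableType d) (Pr : probability Omega R).
Context (Psi : {mfun Omega >-> R}) (eta : nat -> {mfun Omega >-> R})
  (w : nat -> {mfun Omega >-> borel W}) (A : nat -> nat -> {mfun Omega >-> bool}).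

Definition weights (omega : Omega) : seqspace R := fun i => eta i omega.

Definition labels (omega : Omega) : seqspace (borel W) := fun i => w i omega.

(* sum_i eta_i delta_{w_i} has law SP(nu, f), nu(dw, ds) = lambda(s) ds P(dw),
   with latent variable Psi. *)
Definition scaled_process (P : probability (borel W) R) (lambda f : R -> R) :
    Prop :=
  (exists2 L : R.-pker R ~> seqspace R, scaled_jumps_kernel lambda L &
     forall (D : set R) (E : set (seqspace R)), measurable D -> measurable E ->
       Pr (Psi @^-1` D `&` weights @^-1` E) =
       \int[lebesgue_measure]_(a in D) ((f a)%:E * L a E)) /\
  (forall (G : set (R * seqspace R)) (N : nat) (B : nat -> set (borel W)),
     measurable G -> (forall i, measurable (B i)) ->
     Pr ([set omega | G (Psi omega, weights omega)] `&`
         [set omega | forall i, (i < N)%N -> B i (w i omega)]) =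
     Pr [set omega | G (Psi omega, weights omega)] * \prod_(i < N) P (B i)).

(* Given (Psi, eta, w), the A_{j,i} are independent Bernoulli(eta_i). Since
   (eta, w) is a.s. a function of mu = sum_i eta_i delta_{w_i} and this
   conditional law does not involve Psi, it says that given mu the Z_j below are
   i.i.d. BeP(mu), and that they are then independent of Psi. *)
Definition bernoulli_displays : Prop :=
  forall (G : set (R * seqspace R * seqspace (borel W))) (n N : nat)
    (b : nat -> nat -> bool), measurable G ->
    Pr ([set omega | G (Psi omega, weights omega, labels omega)] `&`
        [set omega | forall j i, (j < n)%N -> (i < N)%N ->
                       A j i omega = b j i]) =
    \int[Pr]_(omega in [set omega | G (Psi omega, weights omega, labels omega)])
      (\prod_(j < n) \prod_(i < N)
         (if b j i then eta i omega else 1 - eta i omega)%R)%:E.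

(* The random measure Z_{j+1} = sum_i A_{j,i} delta_{w_i}: individuals are
   numbered from 0. *)
Definition feature_measure (j : nat) (omega : Omega) (B : set W) : \bar R :=
  \sum_(0 <= i <oo) ((A j i omega : nat)%:R%:E * \d_(w i omega) B).

(* The sigma-algebra generated by (Z_1, ..., Z_n). *)
Definition sample_events (n : nat) : set (set Omega) :=
  <<s [set E | exists (j : nat) (B : set (borel W)) (Y : set (\bar R)),
         [/\ (j < n)%N, measurable B, measurable Y &
             E = [set omega | Y (feature_measure j omega B)]]] >>.

Definition displays (j : nat) (omega : Omega) (x : W) : Prop :=
  0 < feature_measure j omega [set x].

(* [m = m_1, ..., m_k]: the first n individuals display exactly k distinct
   features, with frequencies m, for some enumeration s of these features. *)
Definition sampling_information (n : nat) (omega : Omega) (m : seq nat) : Prop :=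
  exists s : seq W,
    [/\ uniq s,
        forall x, x \in s <-> exists2 j, (j < n)%N & displays j omega x &
        m = [seq (\sum_(j < n) `[< displays j omega x >])%N | x <- s]].

Definition regular_conditional_distribution (n : nat)
    (kappa : Omega -> probability R R) : Prop :=
  (forall (D : set R) (Y : set (\bar R)), measurable D -> measurable Y ->
     sample_events n [set omega | Y (kappa omega D)]) /\
  (forall (D : set R) (E : set Omega), measurable D -> sample_events n E ->
     Pr (Psi @^-1` D `&` E) = \int[Pr]_(omega in E) kappa omega D).

(* q is the conditional distribution of Psi given (Z_1, ..., Z_n), as a function
   of the sampling information (n, k, m_1, ..., m_k). *)
Definition posterior (n : nat) (q : seq nat -> probability R R) : Prop :=
  exists2 kappa : Omega -> probability R R,
    regular_conditional_distribution n kappa &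
    {ae Pr, forall omega, forall m, sampling_information n omega m ->
       forall D : set R, measurable D -> kappa omega D = q m D}.

Definition posterior_depends_only_on_sample_size : Prop :=
  forall n : nat, (1 <= n)%N ->
    exists2 q : seq nat -> probability R R, posterior n q &
      forall m m' : seq nat,
        all (fun i => 1 <= i <= n)%N m -> all (fun i => 1 <= i <= n)%N m' ->
        forall D : set R, measurable D -> q m D = q m' D.

End FeatureModel.

(* Main.v *)
Require Import Defs.
From HB Require Import structures.
From mathcomp Require Import all_boot all_order all_algebra.
From mathcomp Require Import all_classical all_reals all_analysis.
From mathcomp Require Import measurable_realfun ring.

Set Implicit Arguments.
Unset Strict Implicit.
Unset Printing Implicit Defensive.

Import Order.TTheory GRing.Theory Num.Theory.
Import numFieldNormedType.Exports.

(** The posterior ignores the sample exactly when [Psi] is independent of every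
    sample, and both implications are statements about this independence.

    Suppose that the posterior depends on the sample size only.  Almost every
    sample displays finitely many features, hence has a sampling information,
    so the conditional law of [Psi] given [Z_1] is almost surely one fixed law:
    [Psi] and [Z_1] are independent ([posterior_prior_independence]).  Look at
    the number of features that the first individual displays.  Given
    [Psi = a], a feature of weight [s] is displayed with probability [s] and
    the weights form a Poisson process with intensity [a lambda(a s) ds], so by
    Campbell's formula the mean of this number is

      [phi(a) = int_0^1 s a lambda(a s) ds = a^-1 int_0^a u lambda(u) du]

    ([mean_displays], [scaled_mean]).  Independence gives [phi] the same
    average over every set of values of [Psi]; the density [f] is continuous
    and positive on a dense subset of ]0, r[, hence [phi] is a constant [C]
    there ([constant_weighted_average]).  Thus [int_0^a u lambda(u) du = C a],
    and differentiation gives [a lambda(a) = C].  The constant is positive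
    because [lambda] is not integrable near 0.

    Conversely let [lambda(s) = C / s] on ]0, r[.  Then the intensity
    [a lambda(a s) = C / s] of the scaled jumps is the same for all [a] in
    ]0, r[.  The ordered points of a Poisson process have a law that is
    determined by the intensity ([ordered_poisson_law_unique]), so the weights
    are independent of [Psi] ([weights_independent]).  The labels and the
    displays are drawn from the weights without looking at [Psi], so [Psi] is
    independent of cylinder events of labels and displays
    ([latent_independent_cylinder]), and of the samples by the pi-lambda
    theorem.  The posterior is therefore the prior. *)

Local Open Scope classical_set_scope.
Local Open Scope ring_scope.

(** * Mixtures of measures *)

Lemma total_mass1_setC (R : realType) (d : measure_display)
    (T : measurableType d) (m : {measure set T -> \bar R}) (F : set T) :
  m [set: T] = 1%E -> measurable F -> m (~` F) = (1 - m F)%E.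
Proof.
move=> m1 mF; rewrite -setTD measureD//; last by rewrite [X in (X < _)%E]m1 ltry.
by rewrite setTI [X in (X - _)%E]m1.
Qed.

Lemma measure_eq_ae (R : realType) (d : measure_display)
    (T : measurableType d) (m : {measure set T -> \bar R}) (A B : set T) :
  measurable A -> measurable B -> {ae m, forall x, A x <-> B x} -> m A = m B.
Proof.
move=> mA mB AB; rewrite -[A]setIT -[B]setIT -!integral_indic//.
apply: ge0_ae_eq_integral => //.
- by apply/measurable_EFinP; exact: measurable_indic.
- by apply/measurable_EFinP; exact: measurable_indic.
apply: filterS AB => x ABx _; rewrite !indicE.
have -> // : (x \in A) = (x \in B) by apply/idP/idP; rewrite !inE => /ABx.
Qed.

Section mixture.
Import HBNNSimple.

(** Both sides are additive in [g] and continuous along increasing sequences,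
    and they agree on indicators by hypothesis; approximation by simple
    functions does the rest.  Dirac kernels turn this into the integration rule
    for measures with a density and for image measures. *)
Lemma integral_mixture (R : realType) (d1 d2 : measure_display)
    (S : measurableType d1) (T : measurableType d2)
    (mu : {measure set S -> \bar R}) (k : S -> {measure set T -> \bar R})
    (h : S -> R) (nu : {measure set T -> \bar R}) (g : T -> \bar R) :
  (forall B, measurable B -> measurable_fun setT (fun y => k y B)) ->
  measurable_fun setT h -> (forall y, 0 <= h y) ->
  (forall B, measurable B -> nu B = \int[mu]_y ((h y)%:E * k y B))%E ->
  measurable_fun setT g -> (forall z, 0 <= g z)%E ->
  (\int[nu]_z g z = \int[mu]_y ((h y)%:E * \int[k y]_z g z))%E.
Proof.
move=> mk mh h0 nuE mg g0.
pose g_ := nnsfun_approx measurableT mg.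
have mgn n : measurable_fun setT (EFin \o g_ n) by exact/measurable_EFinP.
have gn0 n z : (0 <= (g_ n z)%:E)%E by rewrite lee_fin.
have gnd z : {homo (fun n => (g_ n z)%:E) : m n / (m <= n)%N >-> (m <= n)%E}.
  by move=> m n mn; rewrite lee_fin; exact/lefP/nd_nnsfun_approx.
have gE z : g z = limn (fun n => (g_ n z)%:E).
  by apply/esym/cvg_lim => //; exact: cvg_nnsfun_approx.
have mki n : measurable_fun setT (fun y => \int[k y]_z (g_ n z)%:E)%E.
  apply: (@measurable_fun_integral_kernel _ _ _ _ R k mk _ _ (mgn n)); exact: gn0.
have step n : (\int[nu]_z (g_ n z)%:E
               = \int[mu]_y ((h y)%:E * \int[k y]_z (g_ n z)%:E))%E.
  have fE (m : {measure set T -> \bar R}) : (\int[m]_z (g_ n z)%:E =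
      \sum_(r \in range (g_ n)) r%:E * m (g_ n @^-1` [set r]))%E.
    rewrite integral_nnsfun// sintegralE (_ : (g_ n) \_ setT = g_ n)//.
    by apply/funext => z; rewrite patchE in_setT.
  rewrite fE; under [RHS]eq_integral do rewrite fE.
  have hk0 r y : (0 <= r%:E * k y (g_ n @^-1` [set r]))%E.
    have := mulemu_ge0 (fun r => g_ n @^-1` [set r]); apply.
    exact: preimage_nnfun0.
  under [RHS]eq_integral => y _ do rewrite ge0_mule_fsumr//.
  rewrite ge0_integral_fsum//; last 2 first.
  - move=> r; apply: emeasurable_funM; first exact/measurable_EFinP.
    by apply: emeasurable_funM => //; exact: mk.
  - by move=> r y _; apply: mule_ge0; [rewrite lee_fin|exact: hk0].
  apply: eq_fsbigr => r _; rewrite nuE//.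
  have [r0|r0] := leP 0 r.
    rewrite -ge0_integralZl//.
    - by apply: eq_integral => y _; rewrite muleCA.
    - by apply: emeasurable_funM; [exact/measurable_EFinP|exact: mk].
    - by move=> y _; rewrite mule_ge0// lee_fin.
  rewrite [LHS](_ : _ = 0)%E.
    by rewrite integral0_eq// => y _; rewrite preimage_nnfun0// measure0 !mule0.
  rewrite integral0_eq ?mule0// => y _.
  by rewrite preimage_nnfun0// measure0 mule0.
transitivity (limn (fun n => \int[nu]_z (g_ n z)%:E)%E).
  by rewrite -monotone_convergence//; apply: eq_integral => z _.
under eq_fun do rewrite step.
have nd y : {homo (fun n => \int[k y]_z (g_ n z)%:E)%E :
              m n / (m <= n)%N >-> (m <= n)%E}.
  move=> m n mn; apply: ge0_le_integral => //; try exact: mgn.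
  by move=> z _; exact: gnd.
rewrite -monotone_convergence//.
- apply: eq_integral => y _.
  rewrite limeMl//; last first.
    by apply: ereal_nondecreasing_is_cvgn => m n; exact: nd.
  by congr *%E; rewrite -monotone_convergence//; apply: eq_integral => z _.
- by move=> n; apply: emeasurable_funM => //; exact/measurable_EFinP.
- by move=> n y _; rewrite mule_ge0 ?lee_fin// integral_ge0.
- by move=> y _ m n mn; rewrite lee_wpmul2l ?lee_fin//; exact: nd.
Qed.

End mixture.

(** The image by [x] of [m] restricted to [E] is a mixture in two ways: of the
    measures [k y] by hypothesis, and of Dirac masses at the points [x omega]
    by construction. *)
Lemma integral_disintegration (R : realType) (d0 d1 d2 : measure_display)
    (Omega : measurableType d0) (S : measurableType d1) (T : measurableType d2)
    (m : {measure set Omega -> \bar R}) (mu : {measure set S -> \bar R})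
    (k : S -> {measure set T -> \bar R}) (h : S -> R)
    (E : set Omega) (x : Omega -> T) (g : T -> \bar R) :
  measurable E -> measurable_fun setT x ->
  (forall B, measurable B -> measurable_fun setT (fun y => k y B)) ->
  measurable_fun setT h -> (forall y, 0 <= h y) ->
  (forall B, measurable B ->
     m (E `&` x @^-1` B) = \int[mu]_y ((h y)%:E * k y B))%E ->
  measurable_fun setT g -> (forall z, 0 <= g z)%E ->
  (\int[m]_(omega in E) g (x omega) = \int[mu]_y ((h y)%:E * \int[k y]_z g z))%E.
Proof.
move=> mE mx mk mh h0 mEx mg g0.
(* The measure structure of an image measure is indexed by the proof that the
   map is measurable, hence the two steps. *)
pose nuf : {measure set T -> \bar R} := pushforward (mrestr m mE) x.
pose nu := nuf mx.
rewrite -(@integral_mixture _ _ _ _ _ mu k h nu)//; last first.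
  by move=> B mB; rewrite -mEx// /nu /nuf /= /pushforward /mrestr setIC.
rewrite (@integral_mixture _ _ _ _ _ m
   (fun o => [the {measure set T -> \bar R} of \d_(x o)])
   (\1_E : Omega -> R) nu)//.
- rewrite integral_mkcond; apply: eq_integral => o _.
  rewrite integral_dirac// diracT mul1e patchE indicE.
  by case: ifPn => _; rewrite ?mul1e ?mul0e.
- move=> B mB; have mx' := mx; apply/measurable_EFinP => /=.
  by apply: measurableT_comp mx'; exact: measurable_indic.
- move=> B mB; rewrite /nu /nuf /= /pushforward /mrestr.
  have mB' : measurable (x @^-1` B).
    by rewrite -[X in measurable X]setTI; exact: (mx measurableT B mB).
  rewrite setIC -[E `&` _]setIT -integral_indic//; last exact: measurableI.
  apply: eq_integral => o _; rewrite -EFinM indicI /=.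
  by rewrite /dirac !indicE.
Qed.

(** Passes from a product rule for events to a product rule for integrals; in
    the applications [E] is an event of a variable independent of [F] and [x],
    and [c] is its probability. *)
Lemma integral_independent_factor (R : realType) (d0 d2 : measure_display)
    (Omega : measurableType d0) (T : measurableType d2)
    (m : {measure set Omega -> \bar R}) (E F : set Omega) (c : R)
    (x : Omega -> T) (g : T -> \bar R) :
  measurable E -> measurable F -> measurable_fun setT x -> 0 <= c ->
  (forall B, measurable B ->
     m (E `&` F `&` x @^-1` B) = c%:E * m (F `&` x @^-1` B))%E ->
  measurable_fun setT g -> (forall z, 0 <= g z)%E ->
  (\int[m]_(omega in E `&` F) g (x omega) =
   c%:E * \int[m]_(omega in F) g (x omega))%E.
Proof.
move=> mE mF mx c0 mEFx mg g0.
have mgx : measurable_fun setT (g \o x) by exact: measurableT_comp.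
rewrite (@integral_disintegration _ _ _ _ _ _ _ m m
    (fun o => [the {measure set T -> \bar R} of \d_(x o)])
    (fun o => c * \1_F o) _ x g)//.
- rewrite [in RHS]integral_mkcond -ge0_integralZl//.
  + apply: eq_integral => o _.
    rewrite integral_dirac// diracT mul1e patchE indicE.
    by case: ifPn => _; rewrite ?mulr1 ?mulr0 ?mule0 ?mul0e.
  + by apply/(measurable_restrictT _ mF).1; exact: measurable_funTS.
  + by move=> o _; rewrite patchE; case: ifP.
- exact: measurableI.
- move=> B mB; apply/measurable_EFinP => /=.
  by apply: measurableT_comp mx; exact: measurable_indic.
- by apply: measurable_funM => //; exact: measurable_indic.
- by move=> y; rewrite mulr_ge0.
- move=> B mB; rewrite mEFx//.
  have mB' : measurable (x @^-1` B).
    by rewrite -[X in measurable X]setTI; exact: (mx measurableT B mB).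
  rewrite -[F `&` _]setIT -integral_indic//; last exact: measurableI.
  rewrite -ge0_integralZl//.
  + apply: eq_integral => o _; rewrite indicI /= /dirac -!EFinM mulrA.
    by rewrite !indicE.
  + by apply/measurable_EFinP; apply: measurable_indic; exact: measurableI.
Qed.

(** * Counting and Poisson variables *)

Section counting_events.
Context (d : measure_display) (T : measurableType d) (R : realType).
Variable E : nat -> set T.
Hypothesis mE : forall i, measurable (E i).

Lemma counting_series (t : T) :
  counting [set i | E i t] = (\sum_(i <oo) (\1_(E i) t)%:E)%E :> \bar R.
Proof.
rewrite counting_dirac; apply: eq_eseriesr => i _.
by rewrite diracE indicE; congr ((_ %:R)%:E); apply/idP/idP; rewrite !inE.
Qed.

Lemma measurable_counting :
  measurable_fun setT (fun t => counting [set i | E i t] : \bar R).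
Proof.
under eq_fun do rewrite counting_series.
apply: ge0_emeasurable_sum => // i _.
by apply/measurable_EFinP; exact: measurable_indic.
Qed.

Lemma integral_counting (m : {measure set T -> \bar R}) (D : set T) :
  measurable D ->
  (\int[m]_(t in D) counting [set i | E i t] = \sum_(i <oo) m (D `&` E i))%E.
Proof.
move=> mD; under eq_integral do rewrite counting_series.
rewrite integral_nneseries//.
  by apply: eq_eseriesr => i _; rewrite integral_indic// setIC.
by move=> i; apply/measurable_EFinP; exact: measurable_indic.
Qed.

End counting_events.

Lemma nneseries_exp (R : realType) (x : R) : 0 <= x ->
  (\sum_(k <oo) (x ^+ k / k`!%:R)%:E = (expR x)%:E)%E.
Proof.
move=> x0; rewrite expRE -EFin_lim; last first.
  by rewrite /pseries -exp_coeffE; exact: is_cvg_series_exp_coeff.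
apply/congr_lim/funext => n/=; rewrite /pseries/= /series/= -sumEFin//.
by under eq_bigr do rewrite mulrC.
Qed.

Lemma poisson_mass_ge0 (R : realType) (mu : \bar R) (k : nat) :
  (0 <= mu)%E -> 0 <= poisson_mass mu k.
Proof.
case: mu => [x| |]//; rewrite lee_fin => x0 /=.
by rewrite divr_ge0// mulr_ge0// ?expR_ge0// exprn_ge0.
Qed.

Lemma sum_poisson_mass (R : realType) (x : R) : 0 <= x ->
  (\sum_(k <oo) (poisson_mass x%:E k)%:E = 1)%E.
Proof.
move=> x0; under eq_eseriesr do rewrite /= -mulrA EFinM.
rewrite nneseriesZl; last by move=> k _; rewrite lee_fin divr_ge0// exprn_ge0.
by rewrite nneseries_exp// -EFinM -expRD addNr expR0.
Qed.

Lemma mean_poisson_mass (R : realType) (x : R) : 0 <= x ->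
  (\sum_(k <oo) (k%:R * poisson_mass x%:E k)%:E = x%:E)%E.
Proof.
move=> x0.
have g0 k : (0 <= (k%:R * poisson_mass x%:E k)%:E)%E.
  by rewrite lee_fin mulr_ge0// poisson_mass_ge0.
rewrite (nneseries_split 0 1)//= add0n big_nat1 mul0r add0e.
rewrite -(nneseries_addn 1)//.
rewrite (eq_eseriesr (g := fun k => x%:E * (poisson_mass x%:E k)%:E)%E).
  rewrite nneseriesZl; last by move=> k _; rewrite lee_fin poisson_mass_ge0.
  by rewrite sum_poisson_mass// mule1.
move=> k _; rewrite -EFinM; congr EFin => /=; rewrite addn1 factS natrM exprS.
have k0 : (k`!%:R : R) != 0 by rewrite pnatr_eq0 -lt0n fact_gt0.
have k1 : (k.+1%:R : R) != 0 by rewrite pnatr_eq0.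
by field; rewrite k0 addrC natr1.
Qed.

Lemma counting_cases (T : choiceType) (R : realType) (S : set T) :
  counting S = +oo%E :> \bar R \/ exists k, counting S = k%:R%:E :> \bar R.
Proof. by rewrite /counting; case: ifP => _; [right; eexists|left]. Qed.

(** With a finite rate the masses of the finite counts sum to 1, so the count
    is almost surely finite and its mean is the usual series.  With an infinite
    rate all finite counts have mass 0, so the count is almost surely
    infinite. *)
Lemma poisson_count_mean (R : realType) (d : measure_display)
    (T : measurableType d) (m : {measure set T -> \bar R}) (N : T -> \bar R)
    (mu : \bar R) :
  m setT = 1%E -> (0 <= mu)%E -> measurable_fun setT N ->
  (forall t, N t = +oo%E \/ exists k, N t = k%:R%:E) ->
  (forall k, m [set t | N t = k%:R%:E] = (poisson_mass mu k)%:E) ->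
  (\int[m]_t N t = mu)%E.
Proof.
move=> m1 mu0 mN Nnat mNk.
pose A k := [set t | N t = k%:R%:E].
have mA k : measurable (A k).
  by rewrite -[A k]setTI; exact: (mN measurableT _ (emeasurable_set1 _)).
have tA : trivIset setT A.
  apply/trivIsetP => i j _ _ /eqP ij; rewrite -subset0 => t [].
  rewrite /A/= => -> [].
  by move/eqP; rewrite eqr_nat => /eqP/ij.
have N0 t : (0 <= N t)%E by case: (Nnat t) => [->|[k ->]]; rewrite ?lee_fin.
pose F := \bigcup_k A k.
have mF : measurable F by exact: bigcupT_measurable.
have mFE : (m F = \sum_(k <oo) (poisson_mass mu k)%:E)%E.
  rewrite measure_bigcup//= eseries_mkcond; apply: eq_eseriesr => k _.
  by rewrite in_setT mNk.
have NF t : (~` F) t -> N t = +oo%E.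
  by case: (Nnat t) => // -[k Nk] Ft; exfalso; apply: Ft; exists k.
case: mu mu0 mNk mFE => [x| |]//; last first.
  move=> _ mNk mFE.
  have mCF : m (~` F) = 1%E.
    have mF0 : m F = 0%E by rewrite mFE eseries0.
    by rewrite total_mass1_setC// mF0 sube0.
  apply/eqP; rewrite -leye_eq.
  have <- : (\int[m]_(t in ~` F) N t = +oo)%E.
    rewrite (eq_integral (cst +oo%E)); last by move=> t /set_mem /NF.
    by rewrite integral_cst ?mCF ?mule1//; exact: measurableC.
  by apply: ge0_subset_integral => //; exact: measurableC.
rewrite lee_fin => x0 mNk mFE.
rewrite sum_poisson_mass// in mFE.
have mCF : m (~` F) = 0%E.
  by rewrite total_mass1_setC// mFE subee.
rewrite -[RHS](mean_poisson_mass x0).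
transitivity (\int[m]_t \sum_(k <oo) ((k%:R)%:E * (\1_(A k) t)%:E))%E; last first.
  rewrite integral_nneseries//.
  - apply: eq_eseriesr => k _; rewrite ge0_integralZl//.
    + by rewrite integral_indic// setIT mNk EFinM.
    + by apply/measurable_EFinP; exact: measurable_indic.
  - move=> k; apply: emeasurable_funM => //.
    by apply/measurable_EFinP; exact: measurable_indic.
apply: ge0_ae_eq_integral => //.
- apply: ge0_emeasurable_sum => // k _; apply: emeasurable_funM => //.
  by apply/measurable_EFinP; exact: measurable_indic.
- by move=> t _; apply: nneseries_ge0.
exists (~` F); split => //; first exact: measurableC.
move=> t /= + [k _ Atk]; apply => _.
rewrite (@nneseriesD1 _ _ k)//= eseries_mkcond eseries0.
  by rewrite indicE mem_set// mule1 adde0.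
move=> j _ _; case: ifPn => // jk; rewrite indicE memNset ?mule0// => Atj.
by move/trivIsetP : tA => /(_ j k Logic.I Logic.I jk); rewrite -subset0 => /(_ t); apply.
Qed.

(** * Campbell's formula *)

(** Both sides are the mean number of points in [B]. *)
Lemma poisson_intensity (R : realType) (d : measure_display)
    (Omega : measurableType d) (m : {measure set Omega -> \bar R})
    (X : nat -> Omega -> R) (U : set R) (rate : R -> R) (B : set R) :
  m [set: Omega] = 1%E -> (forall s, U s -> 0 <= rate s) ->
  ordered_poisson_points m X U rate -> measurable B -> B `<=` U ->
  (\sum_(i <oo) m (X i @^-1` B) = \int[lebesgue_measure]_(s in B) (rate s)%:E)%E.
Proof.
move=> m1 rate0 [mX _ _ Xcount] mB BU.
have mE i : measurable (X i @^-1` B) by rewrite -[X in measurable X]setTI; exact: mX.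
transitivity (\int[m]_omega counting [set i | B (X i omega)])%E.
  rewrite (integral_counting (E := fun i => X i @^-1` B))//.
  by apply: eq_eseriesr => i _; rewrite setTI.
apply: poisson_count_mean => //.
- by apply: integral_ge0 => s Bs; rewrite lee_fin; exact/rate0/BU.
- exact: (measurable_counting mE).
- by move=> t; exact: counting_cases.
move=> k; have := Xcount 1%N (fun=> B) (fun=> k) (fun=> mB) (fun=> BU).
rewrite big_ord1 => <-; last by apply/trivIsetP => i j; rewrite !ord1.
by congr (m _); apply/seteqP; split => [t /= + l|t /= /(_ ord0)].
Qed.

(** The sum of the laws of the points is the measure with density [rate] on
    [U], by [poisson_intensity], and both sides integrate [g] against it. *)
Lemma campbell (R : realType) (d : measure_display)
    (Omega : measurableType d) (m : {measure set Omega -> \bar R})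
    (X : nat -> Omega -> R) (U : set R) (rate : R -> R) (g : R -> \bar R) :
  m [set: Omega] = 1%E -> measurable U -> measurable_fun U rate ->
  (forall s, U s -> 0 <= rate s) -> ordered_poisson_points m X U rate ->
  measurable_fun setT g -> (forall s, 0 <= g s)%E ->
  (\sum_(i <oo) \int[m]_omega g (X i omega) =
   \int[lebesgue_measure]_(s in U) ((rate s)%:E * g s))%E.
Proof.
move=> m1 mU mrate rate0 pX mg g0; have [mX XU _ _] := pX.
pose nuf : {measure set R -> \bar R} :=
  mseries (fun i => [the measure _ _ of pushforward m (X i)]) 0.
pose nu := nuf mX.
transitivity (\int[nu]_s g s)%E.
  rewrite ge0_integral_measure_series//; apply: eq_eseriesr => i _.
  by rewrite [RHS]ge0_integral_pushforward.
have nuU B : measurable B -> nu B = nu (B `&` U).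
  move=> mB; apply: eq_eseriesr => i _; rewrite /= /pushforward.
  apply: measure_eq_ae.
  - by rewrite -[X in measurable X]setTI; exact: (mX i measurableT).
  - rewrite -[X in measurable X]setTI.
    exact: (mX i measurableT _ (measurableI _ _ mB mU)).
  by apply: filterS XU => t Ut /=; split => [|[]].
have rateE s : (rate \_ U) s = rate s * \1_U s.
  by rewrite patchE indicE; case: ifPn => _; rewrite ?mulr1 ?mulr0.
rewrite (@integral_mixture _ _ _ (measurableTypeR R) R lebesgue_measure
  (fun s => [the {measure set R -> \bar R} of \d_(s : R)]) (rate \_ U))//.
- rewrite [RHS]integral_mkcond; apply: eq_integral => s _.
  rewrite integral_dirac// diracT mul1e.
  by rewrite !patchE; case: ifPn => // _; rewrite mul0e.
- by move=> B mB; apply/measurable_EFinP; exact: measurable_indic.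
- exact: (measurable_restrictT _ mU).1.
- by move=> s; rewrite patchE; case: ifPn => // /set_mem /rate0.
move=> B mB; rewrite nuU// /nu /= /mseries.
rewrite (@poisson_intensity _ _ _ _ _ U rate)//; last exact: measurableI.
rewrite integral_mkcond; apply: eq_integral => s _.
rewrite !patchE in_setI diracE.
by case: (s \in B); case: (s \in U); rewrite /= ?mule1 ?mule0 ?mul0e.
Qed.

(** * The law of the ordered points of a Poisson process *)

Lemma measurable_coordinate (d : measure_display) (T : measurableType d) (i : nat) :
  measurable_fun setT (fun x : seqspace T => x i).
Proof.
move=> _ B mB; rewrite setTI; apply: sub_sigma_algebra.
by exists i, B.
Qed.

Lemma measurable_into_seqspace (d d' : measure_display) (S : measurableType d)
    (T : measurableType d') (x : S -> nat -> T) :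
  (forall i, measurable_fun setT (fun s => x s i)) ->
  measurable_fun setT (x : S -> seqspace T).
Proof.
move=> mx.
apply: (@measurability _ _ S (seqspace T) setT x (@cylinders _ T)) => //.
move=> _ [_ [i [B [mB ->]]] <-].
exact: mx.
Qed.

(** Sorting the points of [U] by the first constraint [A l] that they violate
    yields disjoint sets, so that the numbers of points of a Poisson process in
    them are independent. *)
Definition first_hit (R : realType) (U : set R) (A : nat -> set R) (l : nat) : set R :=
  U `&` [set u | ~ A l u /\ forall k, (k < l)%N -> A k u].

Lemma trivIset_first_hit (R : realType) (U : set R) (A : nat -> set R) :
  trivIset setT (first_hit U A).
Proof.
move=> i j _ _ [u [[_ [Ai ltAi]] [_ [Aj ltAj]]]].
by case: (ltngtP i j) => // [/ltAj|/ltAi].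
Qed.

(** The condition on the numbers [c l] of points whose first violated
    constraint is [l] which says that the [i]-th largest point meets the [i]-th
    constraint, for all [i]. *)
Definition slow_counts (N : nat) (c : {ffun 'I_N -> 'I_N.+1}) : Prop :=
  forall i : 'I_N, (\sum_(l < N | (l <= i)%N) c l <= i)%N.

Lemma counting_II (R : realType) (n : nat) : counting `I_n = n%:R%:E :> \bar R.
Proof.
rewrite /counting asboolT; last exact: finite_II.
by rewrite (@card_fset_set _ _ n).
Qed.

(** If all constraints hold, a point [x j] whose first violated constraint is
    [l] lies above [x l], so [j < l]: at most [i] points violate a constraint
    of index at most [i].  If [x i] violates [A i], so do the larger points
    [x 0], ..., [x i], which are already [i + 1] points. *)
Lemma decreasing_counts (R : realType) (U : set R) (A : nat -> set R) (N : nat)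
    (x : nat -> R) :
  (forall i, U (x i)) -> (forall i, x i.+1 < x i) ->
  (forall i u v, u <= v -> A i v -> A i u) ->
  (forall i, (i < N)%N -> A i (x i)) <->
  exists2 c : {ffun 'I_N -> 'I_N.+1}, slow_counts c &
    forall l : 'I_N,
      counting [set j | first_hit U A l (x j)] = (c l : nat)%:R%:E :> \bar R.
Proof.
move=> Ux xdec Ale.
have xlt i j : (i < j)%N -> x j < x i.
  elim: j => // j IH; rewrite ltnS leq_eqVlt => /predU1P[->//|/IH].
  exact: lt_trans.
pose S l := [set j | first_hit U A l (x j)].
have tS (P : set nat) : trivIset P S.
  move=> i j _ _ [k [Sk Sk']].
  by apply: (@trivIset_first_hit _ U A i j) => //; exists (x k).
have sumS (i : 'I_N) : (\sum_(l < N | (l <= i)%N) counting (S l) =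
    counting (\bigcup_(l in [set l : 'I_N | (l <= i)%N]) S l) :> \bar R)%E.
  rewrite (bigcup_pred [pred l : 'I_N | (l <= i)%N]) measure_bigsetU_ord_cond//.
  move=> l l' _ _ ne; apply/val_inj; exact: (tS setT).
split=> [Ax|[c cslow cE] i iN].
- have Slt (l j : nat) : (l < N)%N -> S l j -> (j < l)%N.
    move=> lN [_ [nAl _]]; rewrite ltnNge; apply/negP => lj; apply: nAl.
    apply: Ale (Ax l lN); move: lj; rewrite leq_eqVlt => /predU1P[->//|/xlt/ltW//].
  have cS (l : 'I_N) : {k : nat | (k <= l)%N & counting (S l) = k%:R%:E :> \bar R}.
    apply: cid2; have : (counting (S l) <= l%:R%:E :> \bar R)%E.
      rewrite -counting_II; apply: le_measure; rewrite ?inE//.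
      by move=> j /(Slt _ _ (ltn_ord l)).
    case: (counting_cases R (S l)) => [->//|[k Sk]].
    by rewrite Sk lee_fin ler_nat => kl; exists k.
  pose c := [ffun l : 'I_N => inord (s2val (cS l)) : 'I_N.+1].
  have cE (l : 'I_N) : counting (S l) = (c l : nat)%:R%:E :> \bar R.
    rewrite ffunE inordK; first exact: (s2valP' (cS l)).
    by rewrite ltnS (leq_trans (s2valP (cS l)))// ltnW.
  exists c => // i; rewrite -(@ler_nat R) -lee_fin natr_sum -sumEFin.
  under eq_bigr do rewrite -cE.
  rewrite sumS -(counting_II R i); apply: le_measure; rewrite ?inE//.
  by move=> j [l /= li /(Slt _ _ (ltn_ord l)) jl]; exact: leq_trans jl li.
- apply: contrapT => nAi.
  have := cslow (Ordinal iN).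
  rewrite -(@ler_nat R) -lee_fin natr_sum -sumEFin.
  under eq_bigr do rewrite -cE.
  rewrite sumS => le_i.
  have : (counting `I_i.+1 <= (i%:R)%:E :> \bar R)%E.
    apply: le_trans le_i; apply: le_measure; rewrite ?inE//.
    move=> j /= ji.
    have nAj : ~ A i (x j).
      apply: contra_not nAi; apply: Ale.
      by move: ji; rewrite ltnS leq_eqVlt => /predU1P[->//|/xlt/ltW].
    have exA : exists k, `[< ~ A k (x j) >] by exists i; exact/asboolP.
    have [k /asboolP nAk kmin] := ex_minnP exA.
    have ki : (k <= i)%N by apply: kmin; exact/asboolP.
    exists (Ordinal (leq_ltn_trans ki iN)) => //=.
    split => //; split => // k' k'k; apply: contrapT => nAk'.
    by move: k'k; rewrite ltnNge => /negP; apply; apply: kmin; exact/asboolP.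
  by rewrite counting_II lee_fin ler_nat ltnn.
Qed.

Section law_of_points.
Context (R : realType).
Local Notation mseq := (seqspace R).

(** Boxes whose sides are initial segments of the line, trivial from some index
    on: they generate the product sigma-algebra and are stable under
    intersection. *)
Definition initial_box (E : set mseq) : Prop :=
  exists (A : nat -> set R) (N : nat),
    [/\ forall i, measurable (A i),
        forall i u v, u <= v -> A i v -> A i u,
        forall i, (N <= i)%N -> A i = setT &
        E = [set x : mseq | forall i, A i (x i)]].

Lemma initial_box_measurable : @measurable _ mseq = <<s initial_box >>.
Proof.
apply/seteqP; split; last first.
  apply: smallest_sub; first exact: sigma_algebra_measurable.
  move=> _ [A [N [mA _ _ ->]]].
  rewrite [X in measurable X](_ : _ = \bigcap_i ((fun x : mseq => x i) @^-1` A i)).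
    apply: bigcapT_measurable => i; rewrite -[X in measurable X]setTI.
    exact: measurable_coordinate.
  by apply/seteqP; split => [x /= Ax i _|x /= Ax i]; [exact: Ax|exact: Ax].
apply: smallest_sub; first exact: smallest_sigma_algebra.
move=> _ [i [B [mB ->]]].
have mi : measurable_fun setT (fun x : g_sigma_algebraType initial_box => x i : R).
  apply: (measurability _ (RGenInftyO.measurableE R)).
  move=> _ [_ [t ->] <-]; rewrite setTI; apply: sub_sigma_algebra.
  exists (fun k => if k == i then `]-oo, t[%classic else setT), i.+1; split.
  - by move=> k; case: ifP.
  - move=> k u v uv; case: ifP => //= _; rewrite !in_itv/=.
    exact: le_lt_trans.
  - by move=> k; case: eqP => // ->; rewrite ltnn.
  - apply/seteqP; split => [x /= xt k|x /= /(_ i)]; last by rewrite eqxx.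
    by case: ifP => // /eqP ->.
by have := mi measurableT B mB; rewrite setTI.
Qed.

Lemma initial_box_setI : setI_closed initial_box.
Proof.
move=> _ _ [A [N [mA leA AT ->]]] [B [M [mB leB BT ->]]].
exists (fun i => A i `&` B i), (maxn N M); split.
- by move=> i; exact: measurableI.
- by move=> i u v uv [/(leA _ _ _ uv) Au /(leB _ _ _ uv) Bu].
- by move=> i; rewrite geq_max => /andP[/AT -> /BT ->]; rewrite setTI.
- apply/seteqP; split => [x /= [Ax Bx] i|x /= ABx]; first by split.
  by split => i; have [] := ABx i.
Qed.

Lemma measurable_first_hit (U : set R) (A : nat -> set R) (l : nat) :
  measurable U -> (forall i, measurable (A i)) -> measurable (first_hit U A l).
Proof.
move=> mU mA; apply: measurableI => //.
rewrite (_ : [set u | _] = ~` A l `&` \bigcap_(k in `I_l) A k).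
  by apply: measurableI; [exact: measurableC|exact: bigcap_measurableType].
by apply/seteqP; split => u.
Qed.

Let count_event (U : set R) (A : nat -> set R) (N : nat)
    (c : {ffun 'I_N -> 'I_N.+1}) : set mseq :=
  [set x | forall l : 'I_N,
     counting [set j | first_hit U A l (x j)] = (c l : nat)%:R%:E :> \bar R].

Let measurable_count_event U A N (c : {ffun 'I_N -> 'I_N.+1}) :
  measurable U -> (forall i, measurable (A i)) -> measurable (count_event U A c).
Proof.
move=> mU mA; rewrite (_ : count_event U A c = \bigcap_(l in [set: 'I_N])
  [set x : mseq | counting [set j | first_hit U A l (x j)] = (c l : nat)%:R%:E :> \bar R]).
  apply: fin_bigcap_measurable => // l _; rewrite -[X in measurable X]setTI.
  apply: (@measurable_counting _ mseq R
    (fun j => [set x | first_hit U A l (x j)]) _ measurableT _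
    (emeasurable_set1 _)).
  move=> j; rewrite -[X in measurable X]setTI.
  by apply: measurable_coordinate => //; exact: measurable_first_hit.
by apply/seteqP; split => [x cx l _|x cx l]; exact: cx.
Qed.

(** Up to a null set the box is a finite disjoint union of events which
    prescribe the numbers of points in disjoint sets.  Bounding the coordinates
    from above, and not from below, makes these numbers finite on the box even
    if the intensity has infinite mass. *)
Lemma initial_box_law (m : {measure set mseq -> \bar R}) (U : set R)
    (rate : R -> R) (A : nat -> set R) (N : nat) :
  measurable U -> ordered_poisson_points m (fun i x => x i) U rate ->
  (forall i, measurable (A i)) ->
  (forall i u v, u <= v -> A i v -> A i u) ->
  (forall i, (N <= i)%N -> A i = setT) ->
  (m [set x : mseq | forall i, A i (x i)] =
   \sum_(c \in [set c : {ffun 'I_N -> 'I_N.+1} | slow_counts c])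
     (\prod_(l < N) poisson_mass
        (\int[lebesgue_measure]_(s in first_hit U A l) (rate s)%:E) (c l))%:E)%E.
Proof.
move=> mU [_ XU Xdec Xcount] mA leA AT.
transitivity (m (\bigcup_(c in [set c : {ffun 'I_N -> 'I_N.+1} | slow_counts c])
    count_event U A c)).
  apply: measure_eq_ae.
  - have -> : @measurable _ mseq = <<s initial_box >> by exact: initial_box_measurable.
    by apply: sub_sigma_algebra; exists A, N.
  - apply: fin_bigcup_measurable => // c _; exact: measurable_count_event.
  apply: filterS2 XU Xdec => x xU xdec.
  have H := @decreasing_counts R U A N x xU xdec leA; split => [Ax|[c cslow cE] i].
    by have [c cs cE] := H.1 (fun i _ => Ax i); exists c.
  have [iN|Ni] := ltnP i N; last by rewrite AT.
  by apply: (H.2 _ i iN); exists c.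
rewrite measure_fin_bigcup//=.
- apply: eq_fsbigr => c _; rewrite /count_event.
  rewrite (Xcount N (fun l => first_hit U A l) (fun l => c l))//.
  + by move=> l; exact: measurable_first_hit.
  + by move=> l; exact: subIsetl.
  + move=> l l' _ _ ne; apply/val_inj; exact: (@trivIset_first_hit _ U A).
- move=> c c' _ _ [x [cx c'x]]; apply/ffunP => l; apply/val_inj.
  have := cx l; rewrite (c'x l) => -[/eqP]; rewrite eqr_nat => /eqP.
  by [].
- by move=> c _; exact: measurable_count_event.
Qed.

Lemma ordered_poisson_law_unique (m1 m2 : {measure set mseq -> \bar R})
    (U : set R) (rate1 rate2 : R -> R) :
  m1 [set: mseq] = 1%E -> measurable U ->
  ordered_poisson_points m1 (fun i x => x i) U rate1 ->
  ordered_poisson_points m2 (fun i x => x i) U rate2 ->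
  (forall s, U s -> rate1 s = rate2 s) ->
  forall E, measurable E -> m1 E = m2 E.
Proof.
move=> m1T mU X1 X2 rate12.
apply: (measure_unique initial_box (fun=> setT)).
- exact: initial_box_measurable.
- exact: initial_box_setI.
- move=> _; exists (fun=> setT), 0%N; split => //.
  by apply/seteqP; split.
- by apply/seteqP; split => // x _; exists 0%N.
- move=> _ [A [N [mA leA AT ->]]].
  rewrite (initial_box_law mU X1 mA leA AT) (initial_box_law mU X2 mA leA AT).
  apply: eq_fsbigr => c _; congr EFin; apply: eq_bigr => l _.
  congr poisson_mass; apply: eq_integral => s /set_mem [Us _].
  by rewrite rate12.
- by move=> _; rewrite m1T ltry.
Qed.

End law_of_points.

(** * Weighted averages and primitives *)

(** Denseness yields a point near [a0] where [f] is positive, and continuity a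
    ball around it where [f] exceeds half of its value there. *)
Lemma dense_positivity (R : realType) (f : R -> R) (r : R) (p : set R) (a0 : R) :
  {in `]0, r[, continuous f} ->
  `]0, r[%classic `<=` closure [set a : R | 0 < f a] ->
  0 < a0 < r -> open p -> p a0 ->
  exists a1 e d : R, [/\ 0 < e, 0 < d &
    ball a1 e `<=` [set a | [/\ 0 < a < r, p a & d <= f a]]].
Proof.
move=> cf sf a0r op pa0.
have oI : open (`]0, r[%classic : set R) by exact: interval_open.
have := sf a0; rewrite /= in_itv/= => /(_ a0r).
have nb0 : nbhs a0 (p `&` `]0, r[%classic).
  apply: open_nbhs_nbhs; split; first exact: openI.
  by split => //=; rewrite in_itv.
move=> /(_ _ nb0) [a1 [/= fa1 [pa1 a1r]]].
have fc : f x @[x --> a1] --> f a1 := cf a1 a1r.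
have nb1 : nbhs a1 [set a | f a1 / 2 < f a].
  apply: (fc [set y | f a1 / 2 < y]); apply: open_nbhs_nbhs; split.
    exact: open_gt.
  by rewrite /= ltr_pdivrMr// ltr_pMr// ltrDl.
have nb2 : nbhs a1 (p `&` `]0, r[%classic).
  by apply: open_nbhs_nbhs; split; [exact: openI|split].
have [e /= e0 be] := (nbhs_ballP a1 _).1 (filterI nb1 nb2).
exists a1, e, (f a1 / 2); split => //; first by rewrite divr_gt0.
by move=> a /be [/= fa [pa]]; rewrite in_itv/= => ar; split => //; exact: ltW.
Qed.

(** If [k] took a value smaller or larger than [M], it would stay away from [M]
    on a ball by continuity; some ball inside it carries positive mass of [f]
    by [dense_positivity], and the average over that ball is not [M].  The same
    argument excludes that [M] is infinite. *)
Lemma constant_weighted_average (R : realType) (f k : R -> R) (r : R)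
    (M : \bar R) :
  positive_density f ->
  {in `]0, r[, continuous f} ->
  `]0, r[%classic `<=` closure [set a : R | 0 < f a] ->
  {in `]0, r[, continuous k} -> (forall a, 0 < a < r -> 0 <= k a) ->
  (forall D : set R, measurable D -> D `<=` `]0%R, r[ ->
     \int[lebesgue_measure]_(a in D) (f a * k a)%:E =
     M * \int[lebesgue_measure]_(a in D) (f a)%:E)%E ->
  forall a, 0 < a < r -> M = (k a)%:E.
Proof.
move=> [mf f0 _ intf] cf sf ck k0 fkM a0 a0r.
have oI : open (`]0, r[%classic : set R) by exact: interval_open.
have ok (q : set R) : open q -> open (`]0, r[%classic `&` k @^-1` q).
  move=> oq; rewrite openE => a [/= ar qa].
  apply: filterI; first by apply: open_nbhs_nbhs; split.
  by apply: (ck _ ar); apply: open_nbhs_nbhs; split.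
have mk : measurable_fun `]0, r[ k.
  apply: open_continuous_measurable_fun => //.
  by move=> a /set_mem ar; apply: ck.
have massf (p : set R) : open p -> p a0 -> exists D : set R,
    [/\ measurable D, D `<=` `]0, r[, D `<=` p,
        (0 < \int[lebesgue_measure]_(a in D) (f a)%:E)%E &
        (\int[lebesgue_measure]_(a in D) (f a)%:E < +oo)%E].
  move=> op pa0; have [a1 [e [d [e0 d0 be]]]] := dense_positivity cf sf a0r op pa0.
  have mB : measurable (ball a1 e) by exact: measurable_ball.
  exists (ball a1 e); split => //.
  - by move=> a /be [].
  - by move=> a /be [].
  - apply: (@lt_le_trans _ _ (\int[lebesgue_measure]_(a in ball a1 e) d%:E)%E).
      rewrite integral_cst//.
      rewrite [X in (_ < _ * X)%E](lebesgue_measure_ball a1 (ltW e0)).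
      rewrite -EFinM lte_fin.
      by rewrite mulr_gt0// mulrn_wgt0.
    apply: ge0_le_integral => //.
    + by move=> a _; rewrite lee_fin ltW.
    + by apply/measurable_EFinP; exact: measurable_funTS.
    + by move=> a /be [_ _]; rewrite lee_fin.
  - apply: (@le_lt_trans _ _ 1%E); last by rewrite ltry.
    rewrite -intf; apply: ge0_subset_integral => //.
    + exact/measurable_EFinP.
    + by move=> a _; rewrite lee_fin.
have bounds (D : set R) (c : R) : measurable D -> D `<=` `]0, r[ -> 0 <= c ->
    (0 < \int[lebesgue_measure]_(a in D) (f a)%:E)%E ->
    (\int[lebesgue_measure]_(a in D) (f a)%:E < +oo)%E ->
    ((forall a, D a -> k a <= c) -> (M <= c%:E)%E) /\
    ((forall a, D a -> c <= k a) -> (c%:E <= M)%E).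
  move=> mD Dr c0 i0 ioo.
  have mfD : measurable_fun D f by exact: measurable_funTS.
  have mkD : measurable_fun D k by exact: measurable_funS mk.
  have f0k0 a : D a -> (0 <= (f a * k a)%:E)%E.
    by move=> /Dr; rewrite /= in_itv/= => ar; rewrite lee_fin mulr_ge0// k0.
  have ic : (\int[lebesgue_measure]_(a in D) (f a * c)%:E =
      c%:E * \int[lebesgue_measure]_(a in D) (f a)%:E)%E.
    rewrite -ge0_integralZl//.
    - by apply: eq_integral => a _; rewrite muleC.
    - exact/measurable_EFinP.
    - by move=> a _; rewrite lee_fin.
  have iF : (\int[lebesgue_measure]_(a in D) (f a)%:E)%E \is a fin_num.
    by rewrite ge0_fin_numE// ltW.
  split=> kc;
    rewrite -(@lee_pmul2r _ (\int[lebesgue_measure]_(a in D) (f a)%:E)%E)//;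
    rewrite -fkM// -ic.
  - apply: ge0_le_integral => //.
    + by apply/measurable_EFinP; exact: measurable_funM.
    + by apply/measurable_EFinP; exact: measurable_funM.
    + by move=> a Da; rewrite lee_fin ler_wpM2l// kc.
  - apply: ge0_le_integral => //.
    + by move=> a Da; rewrite lee_fin mulr_ge0.
    + by apply/measurable_EFinP; exact: measurable_funM.
    + by apply/measurable_EFinP; exact: measurable_funM.
    + by move=> a Da; rewrite lee_fin ler_wpM2l// kc.
have kin a : 0 < a < r -> `]0, r[%classic a by rewrite /= in_itv.
have k00 := k0 _ a0r.
apply/eqP; rewrite eq_le; apply/andP; split; apply/lee_addgt0Pr => e e0.
- have [|D [mD Dr Dp i0 ioo]] := massf _ (ok [set y | y < k a0 + e] (@open_lt _ _)).
    by split; [exact: kin|rewrite /= ltrDl].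
  rewrite -EFinD; apply: (bounds D (k a0 + e) mD Dr _ i0 ioo).1.
    by rewrite addr_ge0// ltW.
  by move=> a /Dp [_ /ltW].
- have [|D [mD Dr Dp i0 ioo]] := massf _ (ok [set y | k a0 - e < y] (@open_gt _ _)).
    by split; [exact: kin|rewrite /= gtrBl].
  rewrite -leeBlDr// -EFinB; have [ke|ke] := leP 0 (k a0 - e).
    by apply: (bounds D (k a0 - e) mD Dr ke i0 ioo).2 => a /Dp [_ /ltW].
  apply: (@le_trans _ _ 0%:E); first by rewrite lee_fin ltW.
  apply: (bounds D 0 mD Dr (lexx _) i0 ioo).2 => a /Dr.
  by rewrite /= in_itv/= => /k0.
Qed.

Lemma derivable_primitive (R : realType) (h : R -> R) (r s : R) :
  measurable_fun (`]0%R, +oo[%classic : set R) h ->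
  (forall u, 0 < u -> 0 <= h u) -> {in `]0, +oo[, continuous h} ->
  (\int[lebesgue_measure]_(u in `]0%R, r[) (h u)%:E < +oo)%E ->
  0 < s < r ->
  let H a := fine (\int[lebesgue_measure]_(u in `]0%R, a[) (h u)%:E)%E in
  derivable H s 1 /\ derive1 H s = h s.
Proof.
move=> mh h0 ch hfin /andP[s0 sr].
have sub a b : [set` Interval (BRight (0:R)) (BSide b a)] `<=` (`]0%R, +oo[%classic : set R).
  by move=> x /=; rewrite !in_itv/= => /andP[->].
have -> : (fun a => fine (\int[lebesgue_measure]_(u in `]0%R, a[) (h u)%:E)%E) =
    (fun x => \int[lebesgue_measure]_(t in [set` Interval (BRight (0:R)) (BRight x)]) (h t))%R.
  apply/funext => a; rewrite /Rintegral -integral_itv_bndo_bndc//.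
  by apply/measurable_EFinP; exact: measurable_funS mh.
have [u /andP[su ur]] : exists u, s < u < r.
  by exists ((s + r) / 2); rewrite !midf_lt.
have ih : lebesgue_measure.-integrable [set` Interval (BRight 0) (BRight u)] (EFin \o h).
  apply/integrableP; split.
    by apply/measurable_EFinP; exact: measurable_funS mh.
  apply: le_lt_trans hfin; apply: (@le_trans _ _
      (\int[lebesgue_measure]_(x in [set` Interval (BRight 0%R) (BRight u)]) (h x)%:E)%E).
    rewrite le_eqVlt; apply/orP; left; apply/eqP; apply: eq_integral => x.
    by rewrite inE /= in_itv/= => /andP[x0 _]; rewrite ger0_norm// h0.
  apply: ge0_subset_integral => //.
  - by apply/measurable_EFinP; exact: measurable_funS mh.
  - by move=> x /=; rewrite in_itv/= => /andP[x0 _]; rewrite lee_fin h0.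
  - by move=> x /=; rewrite !in_itv/= => /andP[->] /le_lt_trans; apply.
have s0' : (BRight (0:R) < BRight s)%O by rewrite bnd_simp.
have sin : s \in `]0, +oo[ by rewrite in_itv/= s0.
exact: (continuous_FTC1 su ih s0' (ch s sin)).
Qed.

Lemma linear_primitive_constant (R : realType) (h : R -> R) (r c : R) :
  measurable_fun (`]0%R, +oo[%classic : set R) h ->
  (forall u, 0 < u -> 0 <= h u) -> {in `]0, +oo[, continuous h} ->
  (\int[lebesgue_measure]_(u in `]0%R, r[) (h u)%:E < +oo)%E ->
  (forall a, 0 < a < r ->
     fine (\int[lebesgue_measure]_(u in `]0%R, a[) (h u)%:E)%E = c * a) ->
  forall s, 0 < s < r -> h s = c.
Proof.
move=> mh h0 ch hfin hlin s sr.
have [_ <-] := derivable_primitive mh h0 ch hfin sr.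
rewrite derive1E (near_eq_derive (g := fun a => c * a)).
  by rewrite deriveMl// derive_id mulr1.
have nb : nbhs s [set x | 0 < x < r].
  apply: open_nbhs_nbhs; split => //.
  have := @interval_open R (BRight 0) (BLeft r) isT isT.
  by rewrite set_itvoo.
by apply: filterS nb => x; exact: hlin.
Qed.

(** * The mean number of features of one individual *)

Lemma lebesgue_measure_scale (R : realType) (a : R) (A : set R) :
  0 < a -> measurable A ->
  (a%:E * lebesgue_measure ((fun x => (a * x)%R) @^-1` A) = lebesgue_measure A)%E.
Proof.
move=> a0 mA.
have mf : measurable_fun setT ( *%R a : R -> R) by exact: measurable_funM.
pose nuf : {measure set (measurableTypeR R) -> \bar R} :=
  mscale (NngNum (ltW a0)) [the measure _ _ of pushforward lebesgue_measure
    ( *%R a : measurableTypeR R -> measurableTypeR R)].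
pose nu := nuf mf.
apply/esym; rewrite -[RHS]/(nu A); apply: (@lebesgue_measure_unique _ nu) => //= _ [[x y]] _ <-.
rewrite /nu /nuf /mscale/= /pushforward.
have -> : ( *%R a) @^-1` `]x, y] = `](x / a), (y / a)]%classic.
  by apply/seteqP; split => z /=; rewrite !in_itv/= ltr_pdivrMr// ler_pdivlMr// mulrC.
rewrite !lebesgue_measure_itv/= !lte_fin ltr_pM2r ?invr_gt0//.
by case: ifPn => _; rewrite ?mule0// -EFinB -EFinM -mulrBl mulrC divfK// gt_eqF.
Qed.

Lemma ge0_integral_scale (R : realType) (a : R) (g : R -> \bar R) :
  0 < a -> measurable_fun `]0, a[ g -> (forall s, (0 < s)%R -> 0 <= g s)%E ->
  (a%:E * \int[lebesgue_measure]_(s in `]0%R, 1%R[) g (a * s)%R =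
   \int[lebesgue_measure]_(u in `]0%R, a[) g u)%E.
Proof.
move=> a0 mg g0.
have mf : measurable_fun setT ( *%R a : R -> R) by exact: measurable_funM.
pose nuf : {measure set (measurableTypeR R) -> \bar R} :=
  pushforward lebesgue_measure ( *%R a : measurableTypeR R -> measurableTypeR R).
pose nu := nuf mf.
have -> : `]0%R, 1%R[%classic = ( *%R a) @^-1` `]0, a[.
  by apply/seteqP; split => z /=; rewrite !in_itv/= pmulr_rgt0// gtr_pMr.
have g0' u : u \in `]0, a[%classic -> (0 <= g u)%E.
  by rewrite inE /= in_itv/= => /andP[/g0].
rewrite -(@ge0_integral_pushforward _ _ (measurableTypeR R) (measurableTypeR R)
  R ( *%R a) _ lebesgue_measure _ g)//.
rewrite -(@ge0_integral_mscale _ _ _ nu _ _ (NngNum (ltW a0)))//; last first.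
  by move=> u /mem_set /g0'.
by apply: eq_measure_integral => A mA _; exact: lebesgue_measure_scale.
Qed.

Section levy_integrals.
Context (R : realType) (lambda : R -> R).
Hypothesis levy_lambda : levy_density lambda.

Let size_bias u := u * lambda u.

Lemma size_bias_measurable :
  measurable_fun (`]0%R, +oo[%classic : set R) size_bias.
Proof. by case: levy_lambda => ml _ _ _; exact: measurable_funM. Qed.

Lemma size_bias_ge0 u : 0 < u -> 0 <= size_bias u.
Proof. by case: levy_lambda => _ l0 _ _ u0; rewrite mulr_ge0 ?l0// ltW. Qed.

Let minl := (fun s => (Num.min s 1 * lambda s)%:E).

Let mminl : measurable_fun (`]0%R, +oo[%classic : set R) minl.
Proof.
case: levy_lambda => ml _ _ _; apply/measurable_EFinP.
by apply: measurable_funM => //; exact: measurable_minr.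
Qed.

Let minl_ge0 u : 0 < u -> (0 <= minl u)%E.
Proof.
case: levy_lambda => _ l0 _ _ u0; rewrite lee_fin mulr_ge0 ?l0//.
by rewrite le_min ltW/=.
Qed.

(** Comparison with [min(u, 1) * lambda u], which is integrable. *)
Lemma levy_bound (D : set R) (g : R -> R) (c : R) :
  measurable D -> D `<=` `]0, +oo[ -> measurable_fun D g ->
  (forall u, D u -> 0 <= g u) -> 0 <= c ->
  (forall u, D u -> g u <= c * Num.min u 1 * lambda u) ->
  (\int[lebesgue_measure]_(u in D) (g u)%:E < +oo)%E.
Proof.
move=> mD D0 mg g0 c0 gc; case: levy_lambda => ml l0 lfin _.
have D0' u : D u -> 0 < u by move/D0; rewrite /= in_itv/= andbT.
apply: (@le_lt_trans _ _ (c%:E * \int[lebesgue_measure]_(u in `]0%R, +oo[) minl u)%E).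
  rewrite -ge0_integralZl//; last first.
    by move=> u; rewrite /= in_itv/= andbT => /minl_ge0.
  apply: (@le_trans _ _ (\int[lebesgue_measure]_(u in D) (c%:E * minl u))%E).
    apply: ge0_le_integral => //.
    - exact/measurable_EFinP.
    - by apply: emeasurable_funM => //; exact: measurable_funS mminl.
    - by move=> u Du; rewrite -EFinM lee_fin mulrA gc.
  apply: ge0_subset_integral => //.
  - by apply: emeasurable_funM.
  - by move=> u; rewrite /= in_itv/= andbT => /minl_ge0 ?; rewrite mule_ge0 ?lee_fin.
by apply: lte_mul_pinfty; rewrite ?lee_fin.
Qed.

Lemma size_bias_integral_fin (a : R) :
  (\int[lebesgue_measure]_(u in `]0%R, a[) (size_bias u)%:E < +oo)%E.
Proof.
have sub : `]0, a[ `<=` (`]0%R, +oo[%classic : set R).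
  by move=> x /=; rewrite !in_itv/= => /andP[->].
apply: (@levy_bound _ _ (Num.max a 1)) => //.
- by apply: measurable_funS size_bias_measurable.
- by move=> u /=; rewrite in_itv/= => /andP[/size_bias_ge0].
- by rewrite le_max ler01 orbT.
case: levy_lambda => _ l0 _ _ u /=; rewrite in_itv/= => /andP[u0 ua].
rewrite /size_bias ler_wpM2r ?l0//.
have [u1|u1] := leP u 1; last by rewrite mulr1 le_max (ltW ua).
by apply: ler_peMl; [exact: ltW|rewrite le_max lexx orbT].
Qed.

(** If [lambda] vanished near 0, it would be at most a multiple of
    [min(u, 1) * lambda u], hence integrable. *)
Lemma levy_infinite_activity (r : R) :
  0 < r -> ~ (forall s, 0 < s < r -> lambda s = 0).
Proof.
move=> r0 l_eq0; case: levy_lambda => ml l0 _ linf.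
have m0 : 0 < Num.min r 1 by rewrite lt_min r0/=.
suff : (\int[lebesgue_measure]_(s in `]0%R, +oo[) (lambda s)%:E < +oo)%E.
  by rewrite linf.
apply: (@levy_bound _ _ (Num.min r 1)^-1) => //.
- by move=> u /=; rewrite in_itv/= andbT => /l0.
- by rewrite invr_ge0 ltW.
move=> u /=; rewrite in_itv/= andbT => u0.
have [ur|ru] := ltP u r; first by rewrite l_eq0 ?mulr0// u0.
rewrite ler_peMl ?l0// mulrC ler_pdivlMr// mul1r.
by rewrite le_min !ge_min ru lexx orbT.
Qed.

(** The left-hand side is the mean number of features of one individual when
    the latent variable is [a]; the substitution is [u = a * s]. *)
Lemma scaled_mean (a : R) : 0 < a ->
  (\int[lebesgue_measure]_(s in `]0%R, 1%R[) ((a * lambda (a * s))%:E * `|s|%:E) =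
   (a^-1)%:E * \int[lebesgue_measure]_(u in `]0%R, a[) (size_bias u)%:E)%E.
Proof.
move=> a0; rewrite -(@ge0_integral_scale _ a (EFin \o size_bias))//.
- rewrite muleA -EFinM mulVf ?gt_eqF// mul1e.
  apply: eq_integral => s; rewrite inE/= in_itv/= => /andP[s0 _].
  by rewrite /size_bias -EFinM gtr0_norm// mulrAC.
- apply/measurable_EFinP; apply: measurable_funS size_bias_measurable => //.
  by move=> x /=; rewrite !in_itv/= => /andP[->].
- by move=> s /size_bias_ge0; rewrite lee_fin.
Qed.

(** The hypothesis says that the mean number of features has the same average
    over every set of values of the latent variable.  It is then constant, the
    primitive of [u * lambda u] is linear, and its derivative is constant. *)
Lemma constant_mean_inverse_density (f : R -> R) (r : R) (M : \bar R) :
  0 < r -> positive_density f -> {in `]0, r[, continuous f} ->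
  `]0, r[%classic `<=` closure [set a : R | 0 < f a] ->
  {in `]0, +oo[, continuous lambda} ->
  (forall D : set R, measurable D -> D `<=` `]0, r[ ->
     (\int[lebesgue_measure]_(a in D) ((f a)%:E *
        \int[lebesgue_measure]_(s in `]0%R, 1%R[) ((a * lambda (a * s))%:E * `|s|%:E)) =
     M * \int[lebesgue_measure]_(a in D) (f a)%:E)%E) ->
  exists2 C : R, 0 < C & forall s : R, 0 < s < r -> lambda s = C * s^-1.
Proof.
move=> r0 df cf sf cl fM.
pose H a := fine (\int[lebesgue_measure]_(u in `]0%R, a[) (size_bias u)%:E)%E.
have H0 a : (0 <= \int[lebesgue_measure]_(u in `]0%R, a[) (size_bias u)%:E)%E.
  by apply: integral_ge0 => u /=; rewrite in_itv/= => /andP[/size_bias_ge0].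
have HE a : (\int[lebesgue_measure]_(u in `]0%R, a[) (size_bias u)%:E = (H a)%:E)%E.
  by rewrite fineK// ge0_fin_numE// size_bias_integral_fin.
have ch : {in `]0, +oo[, continuous size_bias}.
  by move=> x /cl cx; apply: cvgM => //; exact: cvg_id.
have dH s : 0 < s < r -> derivable H s 1 /\ derive1 H s = size_bias s.
  exact: (derivable_primitive size_bias_measurable size_bias_ge0 ch
    (size_bias_integral_fin r)).
have Mk a : 0 < a < r -> M = (a^-1 * H a)%:E.
  move: a; apply: (constant_weighted_average df cf sf).
  - move=> a; rewrite in_itv/= => ar; have /andP[a0 _] := ar.
    apply: cvgM; first by apply: cvgV; [rewrite gt_eqF|exact: cvg_id].
    have [+ _] := dH _ ar => /derivable1_diffP/differentiable_continuous.
    by [].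
  - by move=> a /andP[a0 _]; rewrite mulr_ge0 ?fine_ge0// invr_ge0 ltW.
  move=> D mD Dr; rewrite -fM//; apply: eq_integral => a /set_mem /Dr.
  by rewrite /= in_itv/= => /andP[a0 _]; rewrite scaled_mean// HE -!EFinM.
pose c := (r / 2)^-1 * H (r / 2).
have r2 : 0 < r / 2 < r by rewrite divr_gt0//= ltr_pdivrMr// ltr_pMr// ltrDl.
have hc s : 0 < s < r -> size_bias s = c.
  apply: (linear_primitive_constant size_bias_measurable size_bias_ge0 ch
    (size_bias_integral_fin r)) => a ar; rewrite -/(H a).
  have := Mk _ ar; rewrite (Mk _ r2) => -[]; rewrite -/c => ->.
  by rewrite mulrAC mulVf ?mul1r// gt_eqF//; case/andP: ar.
have lc s : 0 < s < r -> lambda s = c * s^-1.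
  move=> sr; rewrite -(hc _ sr) /size_bias mulrAC mulfV ?mul1r// gt_eqF//.
  by case/andP: sr.
exists c => //; rewrite lt_neqAle; apply/andP; split.
  apply/eqP => c0; apply: (levy_infinite_activity r0) => s sr.
  by rewrite lc// -c0 mul0r.
by rewrite -(hc _ r2) size_bias_ge0//; case/andP: r2.
Qed.

End levy_integrals.

(** * Weights and displays in the feature model *)

Definition unit_weights (R : realType) : set (seqspace R) :=
  [set x | forall i, 0 < x i < 1].
Arguments unit_weights {R}.

(** The probability that a Bernoulli variable of parameter [x] lies in [s].  The
    full set [s] leaves the variable unconstrained, so that one product formula
    covers the marginal laws as well. *)
Definition display_prob (R : realType) (s : pred bool) (x : R) : R :=
  \sum_(b : bool | s b) (if b then x else 1 - x).

Lemma measurable_unit_weights (R : realType) : measurable (@unit_weights R).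
Proof.
rewrite (_ : unit_weights = \bigcap_i
    ((fun x : seqspace R => x i) @^-1` `]0, 1[%classic)).
  apply: bigcapT_measurable => i; rewrite -[X in measurable X]setTI.
  by apply: measurable_coordinate.
by apply/seteqP; split => [x /= xU i _|x /= xU i];
  have := xU i; rewrite /= in_itv/=; [|apply].
Qed.

Lemma measurable_display_prob (R : realType) (s : pred bool) :
  measurable_fun setT (@display_prob R s).
Proof.
rewrite /display_prob; under eq_fun do rewrite big_mkcond.
apply: measurable_sum => b; case: (s b) => //; case: b => //.
exact: measurable_funB.
Qed.

Section model.
Context (R : realType) (W : completePseudoMetricType R)
  (d : measure_display) (Omega : measurableType d) (Pr : probability Omega R).
Context (Psi : {mfun Omega >-> R}) (eta : nat -> {mfun Omega >-> R})
  (w : nat -> {mfun Omega >-> borel W}) (A : nat -> nat -> {mfun Omega >-> bool}).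

Lemma measurable_weights : measurable_fun setT (weights eta).
Proof. by apply: measurable_into_seqspace => i; exact: measurable_funPT. Qed.

Lemma measurable_labels : measurable_fun setT (labels w).
Proof. by apply: measurable_into_seqspace => i; exact: measurable_funPT. Qed.

Lemma measurable_latent (G : set (R * seqspace R * seqspace (borel W))) :
  measurable G -> measurable [set omega | G (Psi omega, weights eta omega, labels w omega)].
Proof.
move=> mG.
have mX : measurable_fun setT
    (fun omega => (Psi omega, weights eta omega, labels w omega)).
  apply: measurable_fun_pair; last exact: measurable_labels.
  by apply: measurable_fun_pair => //; exact: measurable_weights.
by have := mX measurableT G mG; rewrite setTI.
Qed.

Lemma measurable_display (j i : nat) (b : bool) :
  measurable [set omega | A j i omega = b].
Proof. exact: (measurable_funPTI (A j i) (Y := [set b])). Qed.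

Hypothesis bernoulli_Z : bernoulli_displays Pr Psi eta w A.

(** Expanding the product of the sums [display_prob] gives one term for each
    complete table of displays allowed by [s], and the event is the disjoint
    union over these tables.  The weights are kept in ]0, 1[ to make all
    integrands nonnegative. *)
Lemma bernoulli_marginals (G : set (R * seqspace R * seqspace (borel W)))
    (n N : nat) (s : nat -> nat -> pred bool) :
  measurable G -> (forall z, G z -> unit_weights z.1.2) ->
  (Pr ([set omega | G (Psi omega, weights eta omega, labels w omega)] `&`
       [set omega | forall j i, (j < n)%N -> (i < N)%N -> s j i (A j i omega)]) =
   \int[Pr]_(omega in [set omega | G (Psi omega, weights eta omega, labels w omega)])
     (\prod_(j < n) \prod_(i < N) display_prob (s j i) (eta i omega))%:E)%E.
Proof.
move=> mG GU.
set G' := [set omega | G _].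
have mG' : measurable G' by exact: measurable_latent.
pose K := ('I_n * 'I_N)%type.
(* a finite table of displays, extended to all indices *)
pose ext (b : {ffun K -> bool}) (j i : nat) :=
  [exists k : K, [&& k.1 == j :> nat, k.2 == i :> nat & b k]].
have extE b (k : K) : ext b k.1 k.2 = b k.
  apply/existsP/idP => [[k' /and3P[/eqP e1 /eqP e2]]|bk]; last first.
    by exists k; rewrite !eqxx bk.
  suff -> : k' = k by [].
  by rewrite [k']surjective_pairing [k]surjective_pairing; congr pair; exact: val_inj.
pose V := [seq b <- enum {: {ffun K -> bool}} | b \in family (fun k : K => s k.1 k.2)].
have uV : uniq V by rewrite filter_uniq// enum_uniq.
pose Ev (b : {ffun K -> bool}) := [set omega | forall j i, (j < n)%N -> (i < N)%N ->
    A j i omega = ext b j i].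
have EvP b omega : Ev b omega <-> forall k : K, A k.1 k.2 omega = b k.
  split=> [Eb k|Eb j i jn iN]; first by rewrite Eb// extE.
  by have := Eb (Ordinal jn, Ordinal iN); rewrite -extE.
have -> : G' `&` [set omega | forall j i, (j < n)%N -> (i < N)%N -> s j i (A j i omega)] =
    \bigcup_(b in [set` V]) (G' `&` Ev b).
  apply/seteqP; split => [omega [Gomega /= As]|omega [b /= bV [Gomega /EvP Eb]]].
    exists [ffun k : K => A k.1 k.2 omega]; last first.
      by split=> //; apply/EvP => k; rewrite ffunE.
    rewrite /= mem_filter mem_enum andbT; apply/familyP => k.
    by rewrite ffunE; exact: As.
  split=> // j i jn iN; move: bV; rewrite mem_filter => /andP[/familyP bs _].
  by have := bs (Ordinal jn, Ordinal iN); rewrite /= -(Eb (Ordinal jn, Ordinal iN)).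
have mEv b : measurable (Ev b).
  rewrite (_ : Ev b = \bigcap_(k in [set: K]) [set omega | A k.1 k.2 omega = b k]).
    apply: fin_bigcap_measurable => [|k _]; first exact: (@finite_finset ('I_n * 'I_N)%type).
    exact: measurable_display.
  apply/seteqP; split => [omega /EvP Eb k _ //|omega Eb].
  by apply/EvP => k; exact: Eb.
rewrite measure_fin_bigcup//=; last 2 first.
- move=> b b' _ _ [omega [[_ /EvP Eb] [_ /EvP Eb']]].
  by apply/ffunP => k; rewrite -Eb -Eb'.
- by move=> b _; exact: measurableI.
rewrite -fsbig_seq//.
under eq_bigr => b _ do rewrite (@bernoulli_Z G n N (ext b) mG).
rewrite -/G' -ge0_integral_sum//; last 2 first.
- move=> b; apply/measurable_EFinP; apply: measurable_prod => j _.
  apply: measurable_prod => i _.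
  case: (ext b j i); first exact: measurable_funTS.
  by apply: measurable_funB => //; exact: measurable_funTS.
- move=> b omega Gomega; rewrite lee_fin; apply: prodr_ge0 => j _.
  apply: prodr_ge0 => i _; have /andP[e0 e1] := GU _ Gomega i.
  by case: ifP => _; [exact: ltW|rewrite subr_ge0 ltW].
apply: eq_integral => omega _; rewrite sumEFin; congr EFin.
rewrite big_filter big_enum_cond/=.
rewrite pair_big/= bigA_distr_big_dep/=.
apply: eq_bigr => b _.
rewrite pair_big/=; apply: eq_bigr => k _.
by rewrite (extE b k).
Qed.

End model.

Section scaled_weights.
Context (R : realType) (W : completePseudoMetricType R)
  (d : measure_display) (Omega : measurableType d) (Pr : probability Omega R).
Context (Psi : {mfun Omega >-> R}) (eta : nat -> {mfun Omega >-> R})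
  (w : nat -> {mfun Omega >-> borel W}) (A : nat -> nat -> {mfun Omega >-> bool}).
Context (P : probability (borel W) R) (lambda f : R -> R).
Hypothesis scaled_mu : scaled_process Pr Psi eta w P lambda f.
Hypothesis bernoulli_Z : bernoulli_displays Pr Psi eta w A.
Hypothesis density_f : positive_density f.
Hypothesis levy_lambda : levy_density lambda.

Lemma kernel_unit_weights (L : R.-pker R ~> seqspace R) (a : R) :
  scaled_jumps_kernel lambda L -> 0 < a -> L a unit_weights = 1%E.
Proof.
move=> [kL _] a0; have [_ xU _ _] := kL _ a0.
rewrite -(@prob_kernel _ _ _ _ R L a); apply: measure_eq_ae => //.
  exact: measurable_unit_weights.
by apply: filterS xU => x xU; split => // _ i; have := xU i; rewrite /= in_itv.
Qed.

Lemma unit_weights_as : {ae Pr, forall omega, unit_weights (weights eta omega)}.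
Proof.
have [[L kL law] _] := scaled_mu.
have mU : measurable (weights eta @^-1` unit_weights).
  rewrite -[X in measurable X]setTI.
  by apply: measurable_weights => //; exact: measurable_unit_weights.
exists (~` (weights eta @^-1` unit_weights)); split => //.
  exact: measurableC.
rewrite probability_setC//.
have := law setT unit_weights measurableT (@measurable_unit_weights R).
rewrite preimage_setT setTI => ->.
have [_ _ f0 intf] := density_f.
rewrite [X in (1 - X)%E](_ : _ = 1%E) ?subee//.
rewrite -[RHS]intf; apply: eq_integral => a _.
have [a0|a0] := ltP 0 a; first by rewrite kernel_unit_weights// mule1.
by rewrite f0// mul0e.
Qed.

(** The weights are almost surely in ]0, 1[; this makes the restriction in
    [bernoulli_marginals] harmless. *)
Lemma latent_unit_weights (X : set Omega) : measurable X ->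
  Pr X = Pr (X `&` weights eta @^-1` unit_weights).
Proof.
move=> mX; apply: measure_eq_ae => //.
  apply: measurableI => //; rewrite -[X in measurable X]setTI.
  by apply: measurable_weights => //; exact: measurable_unit_weights.
by apply: filterS unit_weights_as => omega ou; split => // -[].
Qed.

(** The first individual displays the [i]-th feature with the mean of its weight
    as probability.  After summation over [i] and disintegration along [Psi],
    Campbell's formula evaluates the mean total weight under each [L a]. *)
Lemma mean_displays (D : set R) : measurable D ->
  (\int[Pr]_(omega in Psi @^-1` D) counting [set i | A 0 i omega] =
   \int[lebesgue_measure]_(a in D) ((f a)%:E *
     \int[lebesgue_measure]_(s in `]0%R, 1%R[) ((a * lambda (a * s))%:E * `|s|%:E)))%E.
Proof.
move=> mD.
have [[L kL law] _] := scaled_mu.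
have [mf f0 fneg _] := density_f.
have mPD : measurable (Psi @^-1` D) by exact: measurable_funPTI.
have mU : measurable (weights eta @^-1` unit_weights).
  rewrite -[X in measurable X]setTI.
  by apply: measurable_weights => //; exact: measurable_unit_weights.
have mA i : measurable [set omega | A 0 i omega] by exact: measurable_display.
have mabs : measurable_fun setT (fun s : R => `|s|%:E).
  by apply/measurable_EFinP; exact: normr_measurable.
pose J i a := (\int[L a]_x `|x i|%:E)%E.
have J0 i a : (0 <= J i a)%E by exact: integral_ge0.
have mJ i : measurable_fun setT (J i).
  apply: measurable_fun_integral_kernel => //.
  - by move=> B mB; exact: measurable_kernel.
  - by apply: measurableT_comp mabs _; exact: measurable_coordinate.
have step i : (Pr (Psi @^-1` D `&` [set omega | A 0 i omega]) =
    \int[lebesgue_measure]_a (((f \_ D) a)%:E * J i a))%E.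
  rewrite latent_unit_weights; last exact: measurableI.
  pose G : set (R * seqspace R * seqspace (borel W)) := (D `*` unit_weights) `*` setT.
  have mG : measurable G.
    apply: measurableX => //; apply: measurableX => //.
    exact: measurable_unit_weights.
  have GE : [set omega | G (Psi omega, weights eta omega, labels w omega)] =
      Psi @^-1` D `&` weights eta @^-1` unit_weights.
    by apply/seteqP; split => [omega [[/= Do Uo] _]|omega [Do Uo]]; split.
  have := @bernoulli_marginals _ _ _ _ _ _ _ _ _ bernoulli_Z G 1 i.+1
    (fun _ i' b => (i' == i) ==> b) mG _.
  rewrite GE => H.
  transitivity (Pr (Psi @^-1` D `&` weights eta @^-1` unit_weights `&`
    [set omega | forall j i', (j < 1)%N -> (i' < i.+1)%N -> (i' == i) ==> A j i' omega])).
    congr (Pr _); apply/seteqP; split => [omega [[Do Ao] Uo]|omega [[Do Uo] Ao]].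
      by split => // j i'; rewrite ltnS leqn0 => /eqP -> _; apply/implyP => /eqP ->.
    by split=> //; split=> //; have := Ao 0 i isT (ltnSn i); rewrite eqxx.
  rewrite H; last by move=> z [[]].
  transitivity (\int[Pr]_(omega in Psi @^-1` D `&` weights eta @^-1` unit_weights)
      `|weights eta omega i|%:E)%E.
    apply: eq_integral => omega /set_mem [_ Uo]; congr EFin.
    rewrite big_ord1 big_ord_recr/= big1 ?mul1r.
      rewrite /display_prob big_mkcond/= big_bool eqxx/= addr0 gtr0_norm//.
      by have /andP[] := Uo i.
    move=> k _; rewrite /display_prob ltn_eqF// big_mkcond/= big_bool/=.
    by rewrite addrCA subrr addr0.
  rewrite (@integral_disintegration _ _ _ _ _ _ _ Pr lebesgue_measure L (f \_ D)
    _ (weights eta) (fun x => `|x i|%:E))//.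
  - exact: measurableI.
  - exact: measurable_weights.
  - move=> B mB. exact: (measurable_kernel L B mB).
  - exact: ((measurable_restrictT _ mD).1 (measurable_funTS mf)).
  - by move=> y; rewrite patchE; case: ifP.
  - move=> B mB; have mB' : measurable (weights eta @^-1` B).
      by rewrite -[X in measurable X]setTI; apply: measurable_weights.
    transitivity (Pr (Psi @^-1` D `&` weights eta @^-1` B)).
      by rewrite setIAC; apply/esym/latent_unit_weights; exact: measurableI.
    rewrite law// [LHS]integral_mkcond; apply: eq_integral => a _.
    by rewrite !patchE; case: ifP => _ //; rewrite mul0e.
  - by apply: measurableT_comp mabs _; exact: measurable_coordinate.
rewrite (integral_counting (E := fun i => [set omega | A 0 i omega]))//.
transitivity (\sum_(i <oo) \int[lebesgue_measure]_a (((f \_ D) a)%:E * J i a))%E.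
  by apply: eq_eseriesr => i _; exact: step.
have h0 a : 0 <= (f \_ D) a by rewrite patchE; case: ifP.
rewrite -integral_nneseries//; last 2 first.
- move=> i; apply: emeasurable_funM; last exact: mJ.
  apply/measurable_EFinP; exact: ((measurable_restrictT _ mD).1 (measurable_funTS mf)).
- by move=> i a _; rewrite mule_ge0// lee_fin.
rewrite [RHS]integral_mkcond; apply: eq_integral => a _.
rewrite nneseriesZl//.
have [a0|a0] := ltP 0 a; last first.
  by rewrite !patchE; case: ifP => _; rewrite ?fneg ?mul0e.
rewrite !patchE; case: ifP => _; last by rewrite mul0e.
congr (_ * _)%E; apply: (campbell (U := `]0%R, 1%R[%classic)) => //.
- exact: prob_kernel.
- have [ml _ _ _] := levy_lambda.
  apply: measurable_funM => //.
  have ma : measurable_fun (`]0%R, 1%R[%classic : set R) (fun s : R => a * s).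
    by apply: measurable_funTS; exact: measurable_funM.
  have suba : (fun s : R => a * s) @` `]0%R, 1%R[ `<=` (`]0%R, +oo[%classic : set R).
    by move=> _ [s /= + <-]; rewrite !in_itv/= andbT => /andP[s0 _]; rewrite mulr_gt0.
  exact: (measurable_comp _ suba ml ma).
- have [_ l0 _ _] := levy_lambda.
  move=> s /=; rewrite in_itv/= => /andP[s0 _].
  by rewrite mulr_ge0 ?l0 ?mulr_gt0// ltW.
- by have [+ _] := kL; apply.
Qed.

End scaled_weights.

(** * A posterior that ignores the sample forces an inverse density *)

Section observed_sample.
Context (R : realType) (W : completePseudoMetricType R)
  (d : measure_display) (Omega : measurableType d) (Pr : probability Omega R).
Context (w : nat -> {mfun Omega >-> borel W}) (A : nat -> nat -> {mfun Omega >-> bool}).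

Lemma feature_measureE (j : nat) (omega : Omega) (B : set W) :
  feature_measure w A j omega B = counting [set i | A j i omega /\ B (w i omega)].
Proof.
rewrite counting_dirac; apply: eq_eseriesr => i _.
rewrite !diracE -EFinM; congr EFin; rewrite -natrM mulnb; congr (_ %:R).
by congr nat_of_bool; apply/andP/idP; rewrite !inE.
Qed.

Lemma displaysP (j : nat) (omega : Omega) (x : W) :
  displays w A j omega x <-> exists2 i, A j i omega & w i omega = x.
Proof.
rewrite /displays feature_measureE; split=> [c0|[i Ai wi]].
  apply: contrapT => nx; move: c0; rewrite (_ : [set i | _] = set0) ?measure0 ?ltxx//.
  by rewrite -subset0 => i /= [Ai wi]; apply: nx; exists i.
apply: (@lt_le_trans _ _ (counting [set i])).
  rewrite counting_dirac (@nneseriesD1 _ _ i)//= diracE mem_set//=.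
  by apply: (@lt_le_trans _ _ 1%E) => //; rewrite leeDl// nneseries_ge0.
by apply: le_measure; rewrite ?inE// => _ ->.
Qed.

Lemma measurable_feature_measure (j : nat) (B : set (borel W)) :
  measurable B ->
  measurable_fun setT (fun omega => feature_measure w A j omega B).
Proof.
move=> mB; under eq_fun do rewrite feature_measureE.
apply: (measurable_counting (E := fun i => [set omega | A j i omega] `&` w i @^-1` B)) => i.
by apply: measurableI; [exact: measurable_display|exact: measurable_funPTI].
Qed.

Lemma sample_events_measurable (n : nat) (E : set Omega) :
  sample_events w A n E -> measurable E.
Proof.
apply: smallest_sub; first exact: sigma_algebra_measurable.
move=> _ [j [B [Y [_ mB mY ->]]]].
by have := measurable_feature_measure j mB measurableT mY; rewrite setTI.
Qed.

Lemma single_sampling_information (omega : Omega) :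
  finite_set [set i | A 0 i omega] ->
  exists2 m, sampling_information w A 1 omega m & all (fun i => 1 <= i <= 1)%N m.
Proof.
move=> /finite_seqP [t tE].
pose s := undup [seq (w i omega : W) | i <- t].
have sP x : x \in s <-> displays w A 0 omega x.
  rewrite mem_undup displaysP; split=> [/mapP [i it ->]|[i Ai <-]].
    by exists i => //; have : [set` t] i by []; rewrite -tE.
  apply/mapP; exists i => //; have : [set i | A 0 i omega] i by [].
  by rewrite tE.
exists [seq (\sum_(j < 1) `[< displays w A j omega x >])%N | x <- s].
  exists s; split => //; first exact: undup_uniq.
  move=> x; rewrite sP; split=> [dx|[j]]; first by exists 0%N.
  by rewrite ltnS leqn0 => /eqP ->.
rewrite all_map; apply/allP => x /sP dx /=.
by rewrite big_ord1 asboolT.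
Qed.

End observed_sample.

Section one_individual.
Context (R : realType) (W : completePseudoMetricType R)
  (d : measure_display) (Omega : measurableType d) (Pr : probability Omega R).
Context (Psi : {mfun Omega >-> R}) (eta : nat -> {mfun Omega >-> R})
  (w : nat -> {mfun Omega >-> borel W}) (A : nat -> nat -> {mfun Omega >-> bool}).
Context (P : probability (borel W) R) (lambda f : R -> R).
Hypothesis scaled_mu : scaled_process Pr Psi eta w P lambda f.
Hypothesis bernoulli_Z : bernoulli_displays Pr Psi eta w A.
Hypothesis density_f : positive_density f.
Hypothesis levy_lambda : levy_density lambda.

Lemma latent_law (D : set R) : measurable D ->
  (Pr (Psi @^-1` D) = \int[lebesgue_measure]_(a in D) (f a)%:E)%E.
Proof.
move=> mD; have [[L kL law] _] := scaled_mu.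
have := law D setT mD measurableT; rewrite preimage_setT setIT => ->.
by apply: eq_integral => a _; rewrite (@prob_kernel _ _ _ _ R L a) mule1.
Qed.

Let Z omega : \bar R := counting [set i | A 0 i omega].

Let mZ : measurable_fun setT Z.
Proof.
by apply: (measurable_counting (E := fun i => [set omega | A 0 i omega])) => i;
  exact: measurable_display.
Qed.

(** On a compact subset of ]0, +oo[ the mean [a^-1 * H a] given by [scaled_mean]
    is bounded, because [H] is finite and nondecreasing; a variable with finite
    mean is almost surely finite. *)
Lemma displays_finite_on (b : R) : 0 < b ->
  {ae Pr, forall omega, b^-1 <= Psi omega <= b -> finite_set [set i | A 0 i omega]}.
Proof.
move=> b0; have [mf f0 _ intf] := density_f.
pose D : set R := `[b^-1, b]%classic.
have mD : measurable D by exact: measurable_itv.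
have mPD : measurable (Psi @^-1` D) by exact: measurable_funPTI.
pose H a := (\int[lebesgue_measure]_(u in `]0%R, a[) (u * lambda u)%:E)%E.
have H0 a : (0 <= H a)%E.
  by apply: integral_ge0 => u /=; rewrite in_itv/= => /andP[/(size_bias_ge0 levy_lambda)].
have Hfin a : H a \is a fin_num.
  by rewrite ge0_fin_numE//; exact: (size_bias_integral_fin levy_lambda).
have Hmono x y : x <= y -> (H x <= H y)%E.
  move=> xy; apply: ge0_subset_integral => //.
  - apply/measurable_EFinP; apply: measurable_funS (size_bias_measurable levy_lambda) => //.
    by move=> z /=; rewrite !in_itv/= => /andP[->].
  - by move=> u /=; rewrite in_itv/= => /andP[/(size_bias_ge0 levy_lambda)].
  - by move=> z /=; rewrite !in_itv/= => /andP[-> /lt_le_trans]; apply.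
have minv : measurable_fun (`]0%R, +oo[%classic : set R) (fun a => a^-1).
  apply: open_continuous_measurable_fun; first exact: interval_open.
  move=> a; rewrite inE /= in_itv/= andbT => a0.
  by apply: cvgV; [rewrite gt_eqF|exact: cvg_id].
have iZ : Pr.-integrable (Psi @^-1` D) Z.
  apply/integrableP; split; first exact: measurable_funTS.
  under eq_integral do rewrite gee0_abs//.
  rewrite (mean_displays scaled_mu bernoulli_Z density_f levy_lambda mD).
  have Dpos a : D a -> 0 < a.
    by rewrite /D /= in_itv/= => /andP[ba _]; apply: lt_le_trans ba; rewrite invr_gt0.
  apply: (@le_lt_trans _ _ (\int[lebesgue_measure]_(a in D) (b * fine (H b) * f a)%:E)%E).
    have minvD : measurable_fun D (fun a => a^-1).
      by apply: measurable_funS minv => // a /Dpos; rewrite /= in_itv/= andbT.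
    rewrite (_ : \int[lebesgue_measure]_(a in D) _ =
        \int[lebesgue_measure]_(a in D) (f a * (a^-1 * fine (H a)))%:E)%E; last first.
      apply: eq_integral => a /set_mem /Dpos a0.
      by rewrite scaled_mean// !EFinM fineK.
    apply: ge0_le_integral => //.
    - by move=> a /Dpos a0; rewrite lee_fin !mulr_ge0 ?fine_ge0// invr_ge0 ltW.
    - apply/measurable_EFinP; apply: measurable_funM; first exact: measurable_funTS.
      apply: measurable_funM; first exact: minvD.
      apply: nondecreasing_measurable => // x y xy.
      by apply: fine_le => //; exact: Hmono.
    - by apply/measurable_EFinP; apply: measurable_funM => //; exact: measurable_funTS.
    move=> a Da; have a0 := Dpos _ Da; move: Da; rewrite /D /= in_itv/= => /andP[ba ab].
    rewrite lee_fin mulrC ler_wpM2r//; apply: ler_pM.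
    - by rewrite invr_ge0 ltW.
    - by rewrite fine_ge0.
    - by rewrite invf_ple ?posrE.
    - by apply: fine_le => //; exact: Hmono.
  under eq_integral do rewrite EFinM.
  rewrite ge0_integralZl//; last 3 first.
  - by apply/measurable_EFinP; exact: measurable_funTS.
  - by move=> a _; rewrite lee_fin.
  - by rewrite lee_fin mulr_ge0 ?fine_ge0// ltW.
  apply: lte_mul_pinfty => //; first by rewrite lee_fin mulr_ge0 ?fine_ge0// ltW.
  apply: (@le_lt_trans _ _ 1%E); last by rewrite ltry.
  rewrite -intf; apply: ge0_subset_integral => //.
  + exact/measurable_EFinP.
  + by move=> a _; rewrite lee_fin.
have := integrable_ae mPD iZ; apply: filterS => omega Zfin Dx.
have : Z omega \is a fin_num by apply: Zfin; rewrite /D /= in_itv.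
by rewrite /Z /counting; case: ifPn => // /asboolP.
Qed.

Lemma displays_finite : {ae Pr, forall omega, finite_set [set i | A 0 i omega]}.
Proof.
have Psi_gt0 : {ae Pr, forall omega, 0 < Psi omega}.
  exists (Psi @^-1` `]-oo, 0]); split.
  - exact: measurable_funPTI.
  - rewrite latent_law//; apply: integral0_eq => a.
    by have [_ _ fneg _] := density_f; rewrite /= in_itv/= => /fneg ->.
  - by move=> omega /= /negP; rewrite -leNgt in_itv.
have fin_on : {ae Pr, forall omega, forall k : nat,
    (k.+1%:R : R)^-1 <= Psi omega <= k.+1%:R -> finite_set [set i | A 0 i omega]}.
  by apply/ae_foralln => k; exact: displays_finite_on.
apply: filterS2 Psi_gt0 fin_on => omega P0 fin.
pose k := Num.truncn (Num.max (Psi omega) (Psi omega)^-1).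
have kP : Num.max (Psi omega) (Psi omega)^-1 < k.+1%:R by exact: truncnS_gt.
move: kP; rewrite gt_max => /andP[k1 k2].
by apply: (fin k); rewrite (ltW k1) andbT invf_ple ?posrE// ltW.
Qed.

(** Almost every sample of size one has a sampling information, so the
    conditional law of [Psi] is almost surely the law attached to the empty
    one.  A constant conditional law is the law of [Psi], which is
    independence. *)
Lemma posterior_prior_independence :
  posterior_depends_only_on_sample_size Pr Psi w A ->
  forall (D : set R) (E : set Omega), measurable D -> sample_events w A 1 E ->
    Pr (Psi @^-1` D `&` E) = (Pr (Psi @^-1` D) * Pr E)%E.
Proof.
move=> /(_ 1%N isT) [q [kappa [mkappa kappaE] kappaq] qcst].
have kappa_cst (D : set R) : measurable D ->
    {ae Pr, forall omega, kappa omega D = q [::] D}.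
  move=> mD; apply: filterS2 kappaq displays_finite => omega kq fin.
  have [m im m1] := single_sampling_information w fin.
  by rewrite (kq m im D mD); apply: qcst.
have key (D : set R) (E : set Omega) : measurable D -> sample_events w A 1 E ->
    Pr (Psi @^-1` D `&` E) = (q [::] D * Pr E)%E.
  move=> mD sE; have mE := sample_events_measurable sE.
  rewrite kappaE// -integral_cst//; apply: ge0_ae_eq_integral => //.
  - move=> _ Y mY; apply: measurableI => //.
    by have := sample_events_measurable (mkappa D Y mD mY).
  - by apply: filterS (kappa_cst D mD) => omega + _.
have sT : sample_events w A 1 setT.
  apply: sub_sigma_algebra; exists 0%N, setT, setT; split => //.
move=> D E mD sE; rewrite key//; congr (_ * _)%E.
by have := key D setT mD sT; rewrite setIT probability_setT mule1.
Qed.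

(** The number of features of the first individual is a function of the sample,
    namely the total mass of its feature measure, so its mean over an event of
    [Psi] is proportional to the probability of this event. *)
Lemma independence_inverse_density (r : R) :
  (forall (D : set R) (E : set Omega), measurable D -> sample_events w A 1 E ->
    Pr (Psi @^-1` D `&` E) = (Pr (Psi @^-1` D) * Pr E)%E) ->
  0 < r -> {in `]0, r[, continuous f} ->
  `]0, r[%classic `<=` closure [set a : R | 0 < f a] ->
  {in `]0, +oo[, continuous lambda} ->
  exists2 C : R, 0 < C & forall s : R, 0 < s < r -> lambda s = C * s^-1.
Proof.
move=> ind r0 cf sf cl.
apply: (constant_mean_inverse_density levy_lambda (M := (\int[Pr]_omega Z omega)%E)
  r0 density_f cf sf cl) => D mD Dr.
have mPD : measurable (Psi @^-1` D) by exact: measurable_funPTI.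
rewrite -(mean_displays scaled_mu bernoulli_Z density_f levy_lambda mD).
rewrite -latent_law// -[X in integral _ X _]setIT.
have PDfin : Pr (Psi @^-1` D) \is a fin_num by rewrite fin_num_measure.
have Zabs X : (\int[Pr]_(omega in X) Z omega = \int[Pr]_(omega in X) `|Z omega|)%E.
  by apply: eq_integral => omega _; rewrite gee0_abs.
rewrite !Zabs (integral_independent_factor (c := fine (Pr (Psi @^-1` D)))
  (x := Z) (g := abse) mPD measurableT mZ)//.
- by rewrite fineK// muleC.
- by rewrite fine_ge0.
move=> B mB; rewrite setIT setTI fineK//; apply: ind => //.
apply: sub_sigma_algebra; exists 0%N, setT, B; split => //.
rewrite /preimage; apply/seteqP; split => omega /=; rewrite feature_measureE;
  rewrite (_ : [set i | A 0 i omega /\ _] = [set i | A 0 i omega])//;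
  by apply/seteqP; split=> i // -[].
Qed.

End one_individual.

(** * With an inverse density the posterior is the prior *)

Section inverse_density.
Context (R : realType) (W : completePseudoMetricType R)
  (d : measure_display) (Omega : measurableType d) (Pr : probability Omega R).
Context (Psi : {mfun Omega >-> R}) (eta : nat -> {mfun Omega >-> R})
  (w : nat -> {mfun Omega >-> borel W}) (A : nat -> nat -> {mfun Omega >-> bool}).
Context (P : probability (borel W) R) (lambda f : R -> R).
Hypothesis scaled_mu : scaled_process Pr Psi eta w P lambda f.
Hypothesis bernoulli_Z : bernoulli_displays Pr Psi eta w A.
Hypothesis density_f : positive_density f.
Hypothesis levy_lambda : levy_density lambda.

(** The intensity [a * lambda (a * s)] equals [C / s] on ]0, 1[ whatever [a] in
    ]0, r[, so the kernel [L] is constant where [f] has its mass. *)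
Lemma weights_independent (r C : R) :
  0 < r -> (forall a : R, a \notin `]0, r[ -> f a = 0) ->
  (forall s, 0 < s < r -> lambda s = C * s^-1) ->
  forall (D : set R) (E : set (seqspace R)), measurable D -> measurable E ->
  (Pr (Psi @^-1` D `&` weights eta @^-1` E) =
   Pr (Psi @^-1` D) * Pr (weights eta @^-1` E))%E.
Proof.
move=> r0 fr lC.
have [[L [kL _] law] _] := scaled_mu; have [mf f0 _ intf] := density_f.
have r2 : 0 < r / 2 < r by rewrite divr_gt0//= ltr_pdivrMr// ltr_pMr// ltrDl.
have rateE a s : 0 < a < r -> 0 < s < 1 -> a * lambda (a * s) = C * s^-1.
  move=> /andP[a0 ar] /andP[s0 s1]; rewrite lC; last first.
    by rewrite mulr_gt0//= (lt_trans _ ar)// gtr_pMr.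
  by rewrite invfM mulrCA mulVKf// gt_eqF.
have Lcst a E : 0 < a < r -> measurable E -> L a E = L (r / 2) E.
  move=> ar mE; apply: (ordered_poisson_law_unique (U := `]0%R, 1%R[%classic)
    _ _ (kL a _) (kL (r / 2) _)) => //.
  - exact: prob_kernel.
  - by case/andP: ar.
  - by case/andP: r2.
  - by move=> s; rewrite /= in_itv/= => s01; rewrite !rateE.
have lawE D E : measurable D -> measurable E ->
    (Pr (Psi @^-1` D `&` weights eta @^-1` E) = Pr (Psi @^-1` D) * L (r / 2)%R E)%E.
  move=> mD mE; rewrite law// (latent_law scaled_mu)//.
  rewrite muleC -ge0_integralZl//; last 2 first.
  - by apply/measurable_EFinP; exact: measurable_funTS.
  - by move=> a _; rewrite lee_fin.
  apply: eq_integral => a _; rewrite muleC.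
  have [ar|/fr ->] := boolP (a \in `]0, r[); last by rewrite !mule0.
  by rewrite Lcst//; move: ar; rewrite in_itv.
move=> D E mD mE; rewrite lawE//; congr (_ * _)%E.
have := lawE setT E measurableT mE.
by rewrite preimage_setT setTI probability_setT mul1e => ->.
Qed.

Definition latent_independent (E : set Omega) : Prop :=
  measurable E /\ forall D : set R, measurable D ->
    Pr (Psi @^-1` D `&` E) = (Pr (Psi @^-1` D) * Pr E)%E.

(** Unlike the sets of counting events that define [sample_events], these events
    are stable under intersection and have an explicit probability. *)
Definition display_cylinder (n : nat) (E : set Omega) : Prop :=
  exists (N : nat) (B : nat -> set (borel W)) (s : nat -> nat -> pred bool),
    [/\ forall i, measurable (B i),
        forall i, (N <= i)%N -> B i = setT /\ forall j b, s j i b &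
        E = [set omega | forall i, B i (w i omega) /\
               forall j, (j < n)%N -> s j i (A j i omega)]].

Lemma display_cylinder_setI (n : nat) : setI_closed (display_cylinder n).
Proof.
move=> _ _ [N [B [s [mB Bs ->]]]] [N' [B' [s' [mB' Bs' ->]]]].
exists (maxn N N'), (fun i => B i `&` B' i), (fun j i b => s j i b && s' j i b).
split.
- by move=> i; exact: measurableI.
- move=> i; rewrite geq_max => /andP[/Bs [-> sT] /Bs' [-> sT']].
  by split; [rewrite setTI|move=> j b; rewrite sT sT'].
- apply/seteqP; split => [omega [Eo E'o] i|omega Eo].
    have [Bi si] := Eo i; have [B'i s'i] := E'o i.
    by split => // j jn; rewrite si// s'i.
  by split=> i; have [[Bi B'i] ss] := Eo i; split => // j /ss /andP[].
Qed.

Lemma sample_events_cylinder (n : nat) (E : set Omega) :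
  sample_events w A n E -> <<s display_cylinder n >> E.
Proof.
apply: smallest_sub; first exact: smallest_sigma_algebra.
move=> _ [j [B [Y [jn mB mY ->]]]].
pose T := g_sigma_algebraType (display_cylinder n).
have mc : measurable_fun setT (fun omega : T =>
    counting [set i | A j i omega /\ B (w i omega)] : \bar R).
  apply: (@measurable_counting _ T R (fun i => [set omega | A j i omega /\ B (w i omega)])).
  move=> i; apply: sub_sigma_algebra.
  exists i.+1, (fun k => if k == i then B else setT),
    (fun j' k b => (j' == j) && (k == i) ==> b); split.
  - by move=> k; case: ifP.
  - move=> k ik; rewrite !gtn_eqF//; split => // j' b.
    by rewrite andbF.
  - apply/seteqP; split => [omega /= [Aj Bw] k|omega /= /(_ i)]; last first.
      by rewrite eqxx => -[Bw /(_ j jn)]; rewrite !eqxx.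
    split; first by case: eqP => [->|].
    by move=> j' _; apply/implyP => /andP[/eqP -> /eqP ->].
have := mc measurableT Y mY; rewrite setTI.
rewrite (_ : _ @^-1` Y = [set omega | Y (feature_measure w A j omega B)])//.
by apply/seteqP; split => omega /=; rewrite feature_measureE.
Qed.

(** On the event that the labels lie in [B], the cylinder has a conditional
    probability which is a function of the weights, by [bernoulli_marginals].
    The labels are independent of [Psi] and the weights, and the weights are
    independent of [Psi], so [Psi] factors out of the integral. *)
Lemma latent_independent_cylinder (n : nat) :
  (forall (D : set R) (E : set (seqspace R)), measurable D -> measurable E ->
    (Pr (Psi @^-1` D `&` weights eta @^-1` E) =
     Pr (Psi @^-1` D) * Pr (weights eta @^-1` E))%E) ->
  forall E, display_cylinder n E -> latent_independent E.
Proof.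
move=> wind _ [N [B [s [mB Bs ->]]]].
set E := [set omega | _].
have [_ lab] := scaled_mu.
have mw (X : set (seqspace R)) : measurable X -> measurable (weights eta @^-1` X).
  move=> mX; rewrite -[X in measurable X]setTI.
  exact: (measurable_weights eta measurableT mX).
have mU := @measurable_unit_weights R.
pose BN := [set l : seqspace (borel W) | forall i, (i < N)%N -> B i (l i)].
have mBN : measurable BN.
  rewrite (_ : BN = \bigcap_(i in `I_N) ((fun l : seqspace (borel W) => l i) @^-1` B i)).
    apply: bigcap_measurableType => i _; rewrite -[X in measurable X]setTI.
    exact: measurable_coordinate.
  by apply/seteqP; split.
pose F := weights eta @^-1` unit_weights `&` labels w @^-1` BN.
have mF : measurable F.
  apply: measurableI; first exact: mw.
  rewrite -[X in measurable X]setTI; exact: (measurable_labels w measurableT mBN).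
pose h (x : seqspace R) := \prod_(j < n) \prod_(i < N) display_prob (s j i) (x i).
have mh : measurable_fun setT h.
  apply: measurable_prod => j _; apply: measurable_prod => i _.
  by apply: measurableT_comp; [exact: measurable_display_prob|exact: measurable_coordinate].
have EE : E = labels w @^-1` BN `&`
    [set omega | forall j i, (j < n)%N -> (i < N)%N -> s j i (A j i omega)].
  apply/seteqP; split => [omega Eo|omega [/= Bo so] i].
    by split=> [i _|j i jn _]; have [Bi si] := Eo i; [|exact: si].
  have [iN|Ni] := ltnP i N; last by have [-> sT] := Bs i Ni; split.
  by split; [exact: Bo|move=> j jn; exact: so].
have mE : measurable E.
  rewrite EE; apply: measurableI.
    rewrite -[X in measurable X]setTI; exact: (measurable_labels w measurableT mBN).
  rewrite (_ : [set omega | _] = \bigcap_(j in `I_n) \bigcap_(i in `I_N)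
      (A j i @^-1` [set b | s j i b])).
    apply: bigcap_measurableType => j _; apply: bigcap_measurableType => i _.
    exact: measurable_funPTI.
  by apply/seteqP; split => [omega so j jn i iN|omega so j i jn iN]; exact: so.
have PE (D : set R) : measurable D -> (Pr (Psi @^-1` D `&` E) =
    \int[Pr]_(omega in Psi @^-1` D `&` F) `|h (weights eta omega)|%:E)%E.
  move=> mD; have mPD : measurable (Psi @^-1` D) by exact: measurable_funPTI.
  rewrite (latent_unit_weights scaled_mu density_f); last exact: measurableI.
  pose G : set (R * seqspace R * seqspace (borel W)) := (D `*` unit_weights) `*` BN.
  have mG : measurable G by apply: measurableX => //; exact: measurableX.
  have GE : [set omega | G (Psi omega, weights eta omega, labels w omega)] =
      Psi @^-1` D `&` F.
    by apply/seteqP; split => [omega [[/= Do Uo] Bo]|omega [Do [Uo Bo]]].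
  have H := @bernoulli_marginals _ _ _ _ _ _ _ _ _ bernoulli_Z G n N s mG _.
  transitivity (Pr (Psi @^-1` D `&` F `&`
      [set omega | forall j i, (j < n)%N -> (i < N)%N -> s j i (A j i omega)])).
    by congr (Pr _); rewrite EE /F; apply/seteqP; split=> [omega [[? []] ? ?]|omega [[? []] ? ?]].
  rewrite GE in H; rewrite H; last by move=> z [[]].
  apply: eq_integral => omega /set_mem [_ [Uo _]]; congr EFin.
  rewrite ger0_norm//; apply: prodr_ge0 => j _; apply: prodr_ge0 => i _.
  apply: sumr_ge0 => b _; have /andP[x0 x1] := Uo i.
  by case: b => /=; [exact: ltW|rewrite subr_ge0 ltW].
split => // D mD.
have mPD : measurable (Psi @^-1` D) by exact: measurable_funPTI.
have PDfin : Pr (Psi @^-1` D) \is a fin_num by rewrite fin_num_measure.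
have PF (X : set R) (Y : set (seqspace R)) : measurable X -> measurable Y ->
    (Pr (Psi @^-1` X `&` F `&` weights eta @^-1` Y) =
     Pr (Psi @^-1` X) * (Pr (weights eta @^-1` (unit_weights `&` Y)) * \prod_(i < N) P (B i)))%E.
  move=> mX mY.
  pose G : set (R * seqspace R) := X `*` (unit_weights `&` Y).
  have mG : measurable G by apply: measurableX => //; exact: measurableI.
  transitivity (Pr ([set omega | G (Psi omega, weights eta omega)] `&`
       [set omega | forall i, (i < N)%N -> B i (w i omega)])).
    congr (Pr _); apply/seteqP; split.
      by move=> omega [[Xo [Uo Bo]] Yo].
    by move=> omega [[Xo [Uo Yo]] Bo].
  rewrite (lab G N B mG mB) muleA; congr (_ * _)%E.
  by rewrite -wind//; exact: measurableI.
rewrite PE// (integral_independent_factor (c := fine (Pr (Psi @^-1` D)))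
   (x := weights eta) (g := fun x => `|h x|%:E) mPD mF).
- rewrite fineK//; congr (_ * _)%E.
  by have := PE setT measurableT; rewrite preimage_setT !setTI => ->.
- exact: measurable_weights.
- exact: fine_ge0.
- move=> Y mY; rewrite fineK//.
  transitivity (Pr (Psi @^-1` D) *
      (Pr (weights eta @^-1` (unit_weights `&` Y)) * \prod_(i < N) P (B i)))%E.
    exact: PF.
  congr (_ * _)%E; have := PF setT Y measurableT mY.
  by rewrite preimage_setT !setTI probability_setT mul1e => <-.
- by apply/measurable_EFinP; apply: measurableT_comp => //; exact: normr_measurable.
- by move=> z; rewrite lee_fin.
Qed.

Lemma latent_independent_sample (n : nat) (E : set Omega) :
  (forall E, display_cylinder n E -> latent_independent E) ->
  sample_events w A n E -> latent_independent E.
Proof.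
move=> cyl /sample_events_cylinder.
apply: (@lambda_system_subset _ (display_cylinder n) (@display_cylinder_setI n) setT) => //.
split => //.
- split => // D mD; rewrite setIT probability_setT mule1//.
- move=> X Y XY [mX iX] [mY iY]; split; first exact: measurableD.
  move=> D mD; have mPD : measurable (Psi @^-1` D) by exact: measurable_funPTI.
  have fX : Pr X \is a fin_num by rewrite fin_num_measure.
  have fY : Pr Y \is a fin_num by rewrite fin_num_measure.
  have fD : Pr (Psi @^-1` D) \is a fin_num by rewrite fin_num_measure.
  have mDX : measurable (Psi @^-1` D `&` X) by exact: measurableI.
  have mDY : measurable (Psi @^-1` D `&` Y) by exact: measurableI.
  have fDX : (Pr (Psi @^-1` D `&` X) < +oo)%E by rewrite ltey_eq fin_num_measure.
  rewrite (_ : _ `&` (X `\` Y) = (Psi @^-1` D `&` X) `\` (Psi @^-1` D `&` Y)); last first.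
    apply/seteqP; split=> [omega [Do [Xo nY]]|omega [[Do Xo] nY]].
      by split=> // -[_ /nY].
    by split=> //; split=> // Yo; apply: nY.
  have -> : Pr (X `\` Y) = (Pr X - Pr Y)%E.
    by rewrite measureD ?ltey_eq ?fX// (setIidr XY).
  have -> : Pr (Psi @^-1` D `&` X `\` Psi @^-1` D `&` Y) =
      (Pr (Psi @^-1` D `&` X) - Pr (Psi @^-1` D `&` Y))%E.
    by rewrite measureD// setIACA setIid (setIidr XY).
  rewrite iX// iY//.
  by rewrite muleBr// fin_num_adde_defr.
- move=> F ndF GF.
  have mF i : measurable (F i) by case: (GF i).
  have mU : measurable (\bigcup_i F i) by exact: bigcupT_measurable.
  split => // D mD; have mPD : measurable (Psi @^-1` D) by exact: measurable_funPTI.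
  have fD : Pr (Psi @^-1` D) \is a fin_num by rewrite fin_num_measure.
  have c1 : Pr (F k) @[k --> \oo] --> Pr (\bigcup_i F i).
    exact: nondecreasing_cvg_mu.
  have c2 : Pr (Psi @^-1` D `&` F k) @[k --> \oo] --> Pr (Psi @^-1` D `&` \bigcup_i F i).
    rewrite setI_bigcupr; apply: nondecreasing_cvg_mu.
    - by move=> i; exact: measurableI.
    - by rewrite -setI_bigcupr; exact: measurableI.
    - move=> i j ij; apply/subsetPset; apply: setIS; apply/subsetPset; exact: ndF.
  apply: (cvg_unique (@ereal_hausdorff R) c2).
  have -> : (fun k => Pr (Psi @^-1` D `&` F k)) = (fun k => (Pr (Psi @^-1` D) * Pr (F k))%E).
    by apply/funext => k; case: (GF k) => _; apply.
  exact: cvgeZl.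
Qed.

(** The law of [Psi] serves as conditional law for every sample. *)
Lemma inverse_density_posterior (r C : R) :
  0 < r -> (forall a : R, a \notin `]0, r[ -> f a = 0) ->
  (forall s, 0 < s < r -> lambda s = C * s^-1) ->
  posterior_depends_only_on_sample_size Pr Psi w A.
Proof.
move=> r0 fr lC n n1.
have ind E : sample_events w A n E -> latent_independent E.
  apply: latent_independent_sample; apply: latent_independent_cylinder.
  exact: weights_independent fr lC.
pose prior : probability R R := distribution Pr Psi.
exists (fun=> prior) => //; exists (fun=> prior); last by apply: aeW.
split.
- move=> D Y mD mY; pose T := g_sigma_algebraType
    [set E | exists (j : nat) (B : set (borel W)) (Y : set (\bar R)),
         [/\ (j < n)%N, measurable B, measurable Y &
             E = [set omega | Y (feature_measure w A j omega B)]]].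
  have [Yc|nYc] := pselect (Y (prior D)).
    rewrite (_ : [set _ | _] = setT); first exact: (@measurableT _ T).
    by apply/seteqP; split.
  rewrite (_ : [set _ | _] = set0); first exact: (@measurable0 _ T).
  by apply/seteqP; split.
- move=> D E mD /ind [mE ->//]; rewrite integral_cst//.
Qed.

End inverse_density.

(** * The characterization *)

Theorem theorem4p1 (R : realType)
  (W : completePseudoMetricType R)
  (hausdorffW : hausdorff_space W)
  (separableW : exists2 S : set W, countable S & dense S)
  (P : probability (borel W) R) (diffuseP : diffuse P)
  (lambda f : R -> R)
  (levy_lambda : levy_density lambda) (density_f : positive_density f)
  (d : measure_display) (Omega : measurableType d) (Pr : probability Omega R)
  (Psi : {mfun Omega >-> R}) (eta : nat -> {mfun Omega >-> R})
  (w : nat -> {mfun Omega >-> borel W})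
  (A : nat -> nat -> {mfun Omega >-> bool})
  (scaled_mu : scaled_process Pr Psi eta w P lambda f)
  (bernoulli_Z : bernoulli_displays Pr Psi eta w A)
  (r : R) (r_gt0 : 0 < r)
  (f_continuous : {in `]0, r[, continuous f})
  (f_vanishes : forall a : R, a \notin `]0, r[ -> f a = 0)
  (f_support : `]0, r[%classic `<=` closure [set a : R | 0 < f a])
  (lambda_continuous : {in `]0, +oo[, continuous lambda}) :
  posterior_depends_only_on_sample_size Pr Psi w A <->
  exists2 C : R, 0 < C & forall s : R, 0 < s < r -> lambda s = C * s^-1.
Proof.
split=> [post|[C C0 lC]].
- apply: (independence_inverse_density scaled_mu bernoulli_Z density_f
    levy_lambda) => //.
  exact: (posterior_prior_independence scaled_mu bernoulli_Z density_f
    levy_lambda).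
- exact: (inverse_density_posterior scaled_mu bernoulli_Z density_f
    r_gt0 f_vanishes lC).
Qed.
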